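(* Let $(M,g)$ be a screen real null submanifold of a normal indefinite complex contact manifold $\overline M$, and let $a\in\{1,2,3\}$. Then the screen distribution $S(TM)$ is integrable if and only if $-A_{J_aX}Y+A_{J_aY}X$ has no component in $\mathrm{Rad}\,TM$ (with respect to $TM=\mathrm{Rad}\,TM\perp S(TM)$) for all $X,Y\in\Gamma(S(TM))$.
   Context: **Ambient manifold.** $\overline{M}$ is a complex contact manifold of complex dimension $2n+1$ (real dimension $4n+2$): it has an open cover with holomorphic 1-forms $\theta_i$ satisfying $\theta_i\wedge(d\theta_i)^n\neq 0$ and $\theta_i=f_{ij}\theta_j$ on overlaps, $f_{ij}$ holomorphic and non-vanishing. $J$ is its complex structure, $\overline{g}$ a Hermitian semi-Riemannian metric of index $4q$, $0<q<n$, with Levi-Civita connection $\overline\nabla$. On each set of the cover there are 1-forms $u$, $v=u\circ J$ (with $\theta=u-iv$ up to a nonvanishing complex-valued function), orthogonal dual vector fields $U$ and $V=-JU$, and (1,1)-tensors $G$, $H=GJ$ with $G^2=H^2=-I+u\otimes U+v\otimes V$, $\overline g(GX,Y)=-\overline g(X,GY)$, $\overline g(U,X)=u(X)$, $GJ=-JG$, $GU=0$, $u(U)=1$; on overlaps $u'=au-bv$, $v'=bu+av$, $G'=aG-bH$, $H'=bG+aH$ with $a^2+b^2=1$. Moreover $du(X,Y)=\overline g(X,GY)+(\sigma\wedge v)(X,Y)$ and $dv(X,Y)=\overline g(X,HY)-(\sigma\wedge u)(X,Y)$, where $\sigma(X)=\overline g(\overline\nabla_XU,V)$. $\mathcal V=\mathrm{Span}\{U,V\}$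 is the (global) characteristic subbundle, $\mathcal{H}=\mathcal V^\perp$ the horizontal one. $\overline M$ is *normal* if $S(X,Y)=T(X,Y)=0$ for $X,Y\in\Gamma(\mathcal H)$ and $S(U,X)=T(V,X)=0$ for all $X$, where, with $[\cdot,\cdot]$ of a tensor denoting its Nijenhuis tensor, $S(X,Y)=[G,G](X,Y)+2\overline g(X,GY)U-2\overline g(X,HY)V+2\{v(Y)HX-v(X)HY\}+\sigma(GY)HX-\sigma(GX)HY+\sigma(X)GHY-\sigma(Y)GHX$, $T(X,Y)=[H,H](X,Y)-2\overline g(X,GY)U+2\overline g(X,HY)V+2\{u(Y)GX-u(X)GY\}+\sigma(HX)GY-\sigma(HY)GX+\sigma(X)GHY-\sigma(Y)GHX$. (Conventions for $d$ and $\wedge$ are those for which, on a normal manifold, $\overline\nabla_XU=-GX+\sigma(X)V$ and $\overline\nabla_XV=-HX-\sigma(X)U$.) Put $J_1=J$, $J_2=G$, $J_3=H$. **Null submanifolds.** A submanifold $M$ of $\overline M$ with induced (degenerate) metric $g$ is *null* if $\mathrm{Rad}\,TM=TM\cap TM^\perp$ is a smooth distribution of constant rank $r>0$. Fix a screen distribution $S(TM)$ (nondegenerate, $TM=\mathrm{Rad}\,TM\perp S(TM)$), a screen transversal bundle $S(TM^\perp)$ (nondegenerate, $TM^\perp=\mathrm{Rad}\,TM\perp S(TM^\perp)$), and the null transversal bundle $l\mathrm{tr}(TM)$, locally spanned by null sections $N_i$ of the orthogonal complement of $S(TM^\perp)$ in $S(TM)^\perp$ with $\overline g(\xi_i,N_j)=\delta_{ij}$,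 $\overline g(N_i,N_j)=0$ for a local basis $\{\xi_i\}$ of $\mathrm{Rad}\,TM$. Then $T\overline M|_M=TM\oplus \mathrm{tr}(TM)$ with $\mathrm{tr}(TM)=l\mathrm{tr}(TM)\perp S(TM^\perp)$. For $X\in\Gamma(TM)$ and $W\in\Gamma(S(TM^\perp))$ write $\overline\nabla_XW=-A_WX+\nabla^s_XW+D^l(X,W)$ with $A_WX\in TM$, $\nabla^s_XW\in S(TM^\perp)$, $D^l(X,W)\in l\mathrm{tr}(TM)$. **Screen real null submanifold.** $\mathcal V\subset S(TM^\perp)$ along $M$, and $J_a\mathrm{Rad}\,TM=\mathrm{Rad}\,TM$ and $J_aS(TM)\subset S(TM^\perp)$ for all $a=1,2,3$. *)

(* Defs.v *)
From HB Require Import structures.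
From mathcomp Require Import all_boot all_order all_algebra all_fingroup.
From mathcomp Require Import complex.
From mathcomp Require Import boolp classical_sets functions reals topology.
From mathcomp Require Import normedtype derive.

Set Implicit Arguments.
Unset Strict Implicit.
Unset Printing Implicit Defensive.

Import Order.TTheory GRing.Theory Num.Theory.
Import numFieldNormedType.Exports.

Local Open Scope classical_set_scope.
Local Open Scope ring_scope.

(** * Bilinear forms and orthogonality on row vectors *)

Definition ip (R : realType) (m : nat) (B : 'M[R]_m) (x y : 'rV[R]_m) : R :=
  (x *m B *m y^T) 0 0.

Definition orthv (R : realType) (m : nat) (B : 'M[R]_m)
    (W : {vspace 'rV[R]_m}) : {vspace 'rV[R]_m} :=
  (\bigcap_(e <- vbasis W) lker (linfun (fun x => ip B e x : R^o)))%VS.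

Lemma memv_orthv (R : realType) (m : nat) (B : 'M[R]_m)
    (W : {vspace 'rV[R]_m}) (x : 'rV[R]_m) :
  x \in orthv B W <-> (forall y, y \in W -> ip B y x = 0).
Proof.
have lin (e : 'rV[R]_m) : linear (fun z : 'rV[R]_m => ip B e z : R^o).
  by move=> a y z; rewrite /ip linearP linearP !mxE.
have evE e z : linfun (fun x => ip B e x : R^o) z = ip B e z.
  pose L := GRing.isLinear.Build R 'rV[R]_m R^o *:%R _ (lin e).
  pose f : {linear 'rV[R]_m -> R^o} :=
    HB.pack (fun z : 'rV[R]_m => ip B e z : R^o) L.
  exact: (lfunE f).
rewrite /orthv; split=> [xW y yW|xW].
- have h (e : 'rV[R]_m) : e \in (vbasis W : seq _) -> ip B e x = 0.
    move=> /seq_tnthP[k ->]; move: xW; rewrite big_tnth memvE => xW.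
    have := subv_trans xW (@bigcapv_inf _ _ _ k _ _ _ isT (subvv _)).
    by rewrite -memvE memv_ker evE => /eqP.
  rewrite (coord_vbasis yW) /ip !mulmx_suml summxE big1 // => k _.
  by rewrite -!scalemxAl mxE [X in _ * X]h ?mulr0 // mem_nth // size_tuple.
- rewrite memvE big_tnth; apply/subv_bigcapP => k _.
  by rewrite -memvE memv_ker evE xW // vbasis_mem // mem_tnth.
Qed.

Definition nondegenerate_on (R : realType) (m : nat) (B : 'M[R]_m)
  (W : {vspace 'rV[R]_m}) : Prop := (W :&: orthv B W = 0)%VS.

Definition negative_definite_on (R : realType) (m : nat) (B : 'M[R]_m)
    (W : {vspace 'rV[R]_m}) : Prop :=
  forall x, x \in W -> x != 0 -> ip B x x < 0.

Definition has_index (R : realType) (m : nat) (B : 'M[R]_m) (k : nat) : Prop :=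
  (exists2 W : {vspace 'rV[R]_m}, negative_definite_on B W & \dim W = k) /\
  (forall W : {vspace 'rV[R]_m}, negative_definite_on B W -> (\dim W <= k)%N).

(** * Smooth maps between normed spaces *)

Fixpoint Ck (R : realType) (V W : normedModType R) (k : nat) (A : set V)
    (f : V -> W) : Prop :=
  match k with
  | 0 => forall x, A x -> {for x, continuous f}
  | k'.+1 => (forall x, A x -> differentiable f x) /\
             (forall v : V, Ck k' A ('D_v f))
  end.

Definition Cinf (R : realType) (V W : normedModType R) (A : set V)
  (f : V -> W) : Prop := forall k, Ck k A f.

(** * Smooth manifolds *)

(* The atlas is indexed by the points: [chart p] is a chart around [p] with
   domain [dom p].  Any manifold has such an atlas of its smooth structure. *)
Record manifold (R : realType) (m : nat) := Manifold {
  pts :> topologicalType;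
  dom : pts -> set pts;
  chart : pts -> pts -> 'rV[R]_m;
  chartV : pts -> 'rV[R]_m -> pts;
  dom_open : forall p, open (dom p);
  dom_mem : forall p, dom p p;
  chart_open : forall p, open (chart p @` dom p);
  chartK : forall p q, dom p q -> chartV p (chart p q) = q;
  chart_continuous : forall p q, dom p q -> {for q, continuous (chart p)};
  chartV_continuous : forall p x,
    (chart p @` dom p) x -> {for x, continuous (chartV p)};
  transition_smooth : forall p q,
    Cinf (chart p @` (dom p `&` dom q)) (chart q \o chartV p);
  manifold_hausdorff : hausdorff_space pts;
  manifold_countable : @second_countable pts
}.

(* The tangent space at [p] is ['rV[R]_m], a vector being given by its
   components in the chart [chart p].  [dirder p x f] is the derivative of [f]
   at [p] along the tangent vector [x]; in particular
   [dirder q y (chart p)] gives the components of [y] (tangent at [q]) in the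
   chart [chart p]. *)
Definition dirder (R : realType) (m : nat) (M : manifold R m)
    (W : normedModType R) (p : M) (x : 'rV[R]_m) (f : M -> W) : W :=
  'D_x (f \o chartV p) (chart p p).

(* The coordinate vector field of [chart p] with constant components [v]. *)
Definition cfield (R : realType) (m : nat) (M : manifold R m)
    (p : M) (v : 'rV[R]_m) (q : M) : 'rV[R]_m :=
  'D_v (chart q \o chartV p) (chart p q).

Definition smooth_on (R : realType) (m : nat) (M : manifold R m)
    (W : normedModType R) (O : set M) (f : M -> W) : Prop :=
  forall p, Cinf (chart p @` (dom p `&` O)) (f \o chartV p).

Definition smooth_map (R : realType) (d m : nat) (M : manifold R d)
    (N : manifold R m) (F : M -> N) : Prop :=
  continuous F /\ forall y : N, smooth_on (F @^-1` dom y) (chart y \o F).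

(* Smooth vector fields along a map [F : M -> N], over the open set [O] of
   [M]; vector fields on [M] are the case [F = idfun]. *)
Definition smooth_along (R : realType) (d m : nat) (M : manifold R d)
    (N : manifold R m) (F : M -> N) (O : set M) (Z : M -> 'rV[R]_m) : Prop :=
  forall y : N, smooth_on (O `&` F @^-1` dom y)
                  (fun q => dirder (F q) (Z q) (chart y)).

Definition smooth_field (R : realType) (m : nat) (M : manifold R m)
  (O : set M) (X : M -> 'rV[R]_m) : Prop := smooth_along (N := M) idfun O X.

(* [X, Y] x^k = X (Y x^k) - Y (X x^k) for the coordinates x^k of [chart p]. *)
Definition bracket (R : realType) (m : nat) (M : manifold R m)
    (X Y : M -> 'rV[R]_m) (p : M) : 'rV[R]_m :=
  dirder p (X p) (fun q => dirder q (Y q) (chart p)) -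
  dirder p (Y p) (fun q => dirder q (X q) (chart p)).

Definition dmap (R : realType) (d m : nat) (M : manifold R d)
    (N : manifold R m) (F : M -> N) (p : M) : 'Hom('rV[R]_d, 'rV[R]_m) :=
  linfun (fun x => dirder p x (chart (F p) \o F)).

Definition smooth_distribution (R : realType) (d m : nat) (M : manifold R d)
    (N : manifold R m) (F : M -> N) (r : nat)
    (D : M -> {vspace 'rV[R]_m}) : Prop :=
  forall p, exists O : set M, exists e : 'I_r -> M -> 'rV[R]_m,
    [/\ open O, O p, forall k, smooth_along F O (e k)
      & forall q, O q -> basis_of (D q) (codom (e ^~ q))].

(** * Differential forms

   The conventions for d and the wedge product carry the factor 1/2, e.g.
   d w (X, Y) = 1/2 (X (w Y) - Y (w X) - w [X, Y]): they are those for which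
   du(X,Y) = g(X,GY) + (sigma /\ v)(X,Y) is compatible with
   nabla_X U = - G X + sigma(X) V.  The bracket term is absent below because
   coordinate vector fields commute. *)

Definition extd (R : realType) (m : nat) (M : manifold R m)
    (w : M -> 'rV[R]_m -> R) (p : M) (x y : 'rV[R]_m) : R :=
  2^-1 * (dirder p x (fun q => w q (cfield p y q) : R^o) -
          dirder p y (fun q => w q (cfield p x q) : R^o)).

Definition wedge (R : realType) (m : nat) (a b : 'rV[R]_m -> R)
    (x y : 'rV[R]_m) : R :=
  2^-1 * (a x * b y - a y * b x).

(** * Semi-Riemannian metrics and connections *)

Definition semi_riemannian (R : realType) (m : nat) (N : manifold R m)
    (g : N -> 'M[R]_m) (k : nat) : Prop :=
  [/\ forall p, (g p)^T = g p,
      forall p, g p \in unitmx,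
      forall p, has_index (g p) k
    & forall (O : set N) X Y, open O -> smooth_field O X -> smooth_field O Y ->
        smooth_on O (fun p => ip (g p) (X p) (Y p) : R^o)].

(* [Gam p] holds the connection coefficients at [p] in the chart [chart p];
   [cov Gam F Z p x] is the covariant derivative along the tangent vector [x]
   of the vector field [Z] along [F], i.e. for the connection pulled back by
   [F]. *)
Definition cov (R : realType) (d m : nat) (M : manifold R d)
    (N : manifold R m) (Gam : N -> 'Hom('rV[R]_m, 'End('rV[R]_m)))
    (F : M -> N) (Z : M -> 'rV[R]_m) (p : M) (x : 'rV[R]_d) : 'rV[R]_m :=
  dirder p x (fun q => dirder (F q) (Z q) (chart (F p))) +
  Gam (F p) (dmap F p x) (Z p).

Definition nabla (R : realType) (m : nat) (N : manifold R m)
    (Gam : N -> 'Hom('rV[R]_m, 'End('rV[R]_m)))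
    (x : 'rV[R]_m) (Y : N -> 'rV[R]_m) (p : N) : 'rV[R]_m :=
  cov (M := N) Gam idfun Y p x.

Definition levi_civita (R : realType) (m : nat) (N : manifold R m)
    (g : N -> 'M[R]_m) (Gam : N -> 'Hom('rV[R]_m, 'End('rV[R]_m))) : Prop :=
  forall (O : set N) (X Y Z : N -> 'rV[R]_m) (p : N),
    open O -> O p ->
    smooth_field O X -> smooth_field O Y -> smooth_field O Z ->
    nabla Gam (X p) Y p - nabla Gam (Y p) X p = bracket X Y p /\
    dirder p (X p) (fun q => ip (g q) (Y q) (Z q) : R^o) =
      ip (g p) (nabla Gam (X p) Y p) (Z p) +
      ip (g p) (Y p) (nabla Gam (X p) Z p).

(** * Complex manifolds *)

(* The real coordinates are (x_1, ..., x_k, y_1, ..., y_k), z_j = x_j + i y_j;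
   [stdJ] sends d/dx_j to d/dy_j and d/dy_j to - d/dx_j. *)
Definition stdJ (R : realType) (k : nat) : 'End('rV[R]_(k + k)) :=
  linfun (mulmxr (block_mx 0 1%:M (- 1%:M) 0)).

(* Holomorphic transition functions.  As a consequence the complex structure
   of the manifold is [stdJ] in every chart, hence, with the representation of
   tangent vectors chosen above, [stdJ] at every point. *)
Definition complex_manifold (R : realType) (k : nat)
    (N : manifold R (k + k)) : Prop :=
  forall (p q : N) x v, (chart p @` (dom p `&` dom q)) x ->
    'D_(stdJ R k v) (chart q \o chartV p) x =
    stdJ R k ('D_v (chart q \o chartV p) x).

Definition cdirder (R : realType) (m : nat) (N : manifold R m) (p : N)
    (x : 'rV[R]_m) (h : N -> R[i]) : R[i] :=
  Complex (dirder p x (fun q => complex.Re (h q) : R^o))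
          (dirder p x (fun q => complex.Im (h q) : R^o)).

Definition holomorphic_on (R : realType) (k : nat) (N : manifold R (k + k))
    (O : set N) (h : N -> R[i]) : Prop :=
  [/\ smooth_on O (fun q => complex.Re (h q) : R^o),
      smooth_on O (fun q => complex.Im (h q) : R^o)
    & forall p x, O p ->
        cdirder p (stdJ R k x) h = Complex 0 1 * cdirder p x h].

(* A complex-valued real-linear form on tangent vectors is stored as the
   column of its values on the canonical basis. *)
Definition ceval (R : realType) (m : nat) (w : 'cV[R[i]]_m) (x : 'rV[R]_m)
  : R[i] := (map_mx (real_complex R) x *m w) 0 0.

Definition holomorphic_form (R : realType) (k : nat) (N : manifold R (k + k))
    (O : set N) (w : N -> 'cV[R[i]]_(k + k)) : Prop :=
  (forall p x, O p ->
     ceval (w p) (stdJ R k x) = Complex 0 1 * ceval (w p) x) /\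
  (forall p v, holomorphic_on (O `&` dom p)
                 (fun q => ceval (w q) (cfield p v q))).

Definition cextd (R : realType) (m : nat) (N : manifold R m)
    (w : N -> 'cV[R[i]]_m) (p : N) (x y : 'rV[R]_m) : R[i] :=
  Complex (extd (fun q z => complex.Re (ceval (w q) z)) p x y)
          (extd (fun q z => complex.Im (ceval (w q) z)) p x y).

(* The value of w /\ (dw)^n on the vectors e_0, ..., e_2n, up to a nonzero
   numerical factor. *)
Definition wedge_power (R : realType) (m n : nat) (N : manifold R m)
    (w : N -> 'cV[R[i]]_m) (p : N) (e : 'I_(n.*2.+1) -> 'rV[R]_m) : R[i] :=
  \sum_(s : 'S_(n.*2.+1)) (-1) ^+ s * (ceval (w p) (e (s ord0)) *
    \prod_(j < n) cextd w p (e (s (inord j.*2.+1))) (e (s (inord j.*2.+2)))).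

(** * Complex contact manifolds *)

Definition rdim (n : nat) : nat := (n.*2.+1 + n.*2.+1)%N.

Definition cJ (R : realType) (n : nat) : 'End('rV[R]_(rdim n)) :=
  stdJ R n.*2.+1.

Record contact_data (R : realType) (n : nat) (N : manifold R (rdim n)) :=
  ContactData {
    cover_index : Type;
    cover_set : cover_index -> set N;
    theta : cover_index -> N -> 'cV[R[i]]_(rdim n);
    fu : cover_index -> N -> 'Hom('rV[R]_(rdim n), R^o);
    fU : cover_index -> N -> 'rV[R]_(rdim n);
    tG : cover_index -> N -> 'End('rV[R]_(rdim n))
  }.

Section ContactData.
Context (R : realType) (n : nat) (N : manifold R (rdim n)).
Context (C : contact_data N).
Implicit Types (i j : cover_index C) (p : N).

Definition fv i p : 'Hom('rV[R]_(rdim n), R^o) := (fu i p \o cJ R n)%VF.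
Definition fV i p : 'rV[R]_(rdim n) := - cJ R n (fU i p).
Definition tH i p : 'End('rV[R]_(rdim n)) := (tG i p \o cJ R n)%VF.

Definition complex_contact : Prop :=
  [/\ (forall i, open (cover_set i)) /\ (forall p, exists i, cover_set i p),
      forall i, holomorphic_form (k := n.*2.+1) (cover_set i) (theta i),
      forall i p, cover_set i p ->
        exists e, wedge_power (n := n) (theta i) p e != 0
    & forall i j, exists f : N -> R[i],
        holomorphic_on (k := n.*2.+1) (cover_set i `&` cover_set j) f /\
        forall p, cover_set i p -> cover_set j p ->
          f p != 0 /\ theta i p = f p *: theta j p].

Context (g : N -> 'M[R]_(rdim n)).
Context (Gam : N -> 'Hom('rV[R]_(rdim n), 'End('rV[R]_(rdim n)))).

Definition hermitian_metric : Prop :=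
  forall p x y, ip (g p) (cJ R n x) (cJ R n y) = ip (g p) x y.

Definition sigma i p (x : 'rV[R]_(rdim n)) : R :=
  ip (g p) (nabla Gam x (fU i) p) (fV i p).

(* - I + u (x) U + v (x) V *)
Definition structure_square i p (A : 'End('rV[R]_(rdim n))) : Prop :=
  forall x, A (A x) = - x + fu i p x *: fU i p + fv i p x *: fV i p.

Definition contact_metric : Prop :=
  [/\ forall i, smooth_field (cover_set i) (fU i) /\
        (forall (O : set N) X, open O -> O `<=` cover_set i -> smooth_field O X ->
           smooth_field O (fun p => tG i p (X p))),
      forall i, exists h : N -> R[i], forall p, cover_set i p ->
        h p != 0 /\
        forall x, ceval (theta i p) x = h p * Complex (fu i p x) (- fv i p x),
      forall i p, cover_set i p ->
        [/\ structure_square i p (tG i p) /\ structure_square i p (tH i p),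
            forall x y, ip (g p) (tG i p x) y = - ip (g p) x (tG i p y),
            (forall x, ip (g p) (fU i p) x = fu i p x) /\
              ip (g p) (fU i p) (fV i p) = 0,
            (tG i p \o cJ R n = - (cJ R n \o tG i p))%VF
          & tG i p (fU i p) = 0 /\ fu i p (fU i p) = 1],
      forall i j, exists a b : N -> R, forall p, cover_set i p -> cover_set j p ->
        [/\ a p ^+ 2 + b p ^+ 2 = 1,
            fu j p = a p *: fu i p - b p *: fv i p,
            fv j p = b p *: fu i p + a p *: fv i p,
            tG j p = a p *: tG i p - b p *: tH i p
          & tH j p = b p *: tG i p + a p *: tH i p]
    & forall i p x y, cover_set i p ->
        extd (fun q z => fu i q z : R) p x y =
          ip (g p) x (tG i p y) +
          wedge (sigma i p) (fun z => fv i p z : R) x y /\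
        extd (fun q z => fv i q z : R) p x y =
          ip (g p) x (tH i p y) -
          wedge (sigma i p) (fun z => fu i p z : R) x y].

Definition nijenhuis (A : N -> 'End('rV[R]_(rdim n)))
    (X Y : N -> 'rV[R]_(rdim n)) p : 'rV[R]_(rdim n) :=
  A p (A p (bracket X Y p)) +
  bracket (fun q => A q (X q)) (fun q => A q (Y q)) p -
  A p (bracket (fun q => A q (X q)) Y p) -
  A p (bracket X (fun q => A q (Y q)) p).

Definition tensorS i (X Y : N -> 'rV[R]_(rdim n)) p : 'rV[R]_(rdim n) :=
  let G := tG i p in let H := tH i p in
  let s := sigma i p in let v := fv i p in
  let x := X p in let y := Y p in
  nijenhuis (tG i) X Y p
  + (2 * ip (g p) x (G y)) *: fU i p - (2 * ip (g p) x (H y)) *: fV i p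
  + 2 *: (v y *: H x - v x *: H y)
  + s (G y) *: H x - s (G x) *: H y + s x *: G (H y) - s y *: G (H x).

Definition tensorT i (X Y : N -> 'rV[R]_(rdim n)) p : 'rV[R]_(rdim n) :=
  let G := tG i p in let H := tH i p in
  let s := sigma i p in let u := fu i p in
  let x := X p in let y := Y p in
  nijenhuis (tH i) X Y p
  - (2 * ip (g p) x (G y)) *: fU i p + (2 * ip (g p) x (H y)) *: fV i p
  + 2 *: (u y *: G x - u x *: G y)
  + s (H x) *: G y - s (H y) *: G x + s x *: G (H y) - s y *: G (H x).

Definition charV i p : {vspace 'rV[R]_(rdim n)} := (<[fU i p]> + <[fV i p]>)%VS.

Definition horizontal i p : {vspace 'rV[R]_(rdim n)} :=
  orthv (g p) (charV i p).

(* S and T only exist over each set of the cover; vector fields range over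
   those defined on an open part of it. *)
Definition normal_contact : Prop :=
  forall i (O : set N) X Y, open O -> O `<=` cover_set i ->
    smooth_field O X -> smooth_field O Y ->
    ((forall p, O p -> X p \in horizontal i p /\ Y p \in horizontal i p) ->
     forall p, O p -> tensorS i X Y p = 0 /\ tensorT i X Y p = 0) /\
    (forall p, O p -> tensorS i (fU i) X p = 0 /\ tensorT i (fV i) X p = 0).

Definition Jtens i (a : 'I_3) p : 'End('rV[R]_(rdim n)) :=
  tnth [tuple cJ R n; tG i p; tH i p] a.

End ContactData.

(** * Null submanifolds *)

Section NullSubmanifolds.
Context (R : realType) (d m : nat) (M : manifold R d) (N : manifold R m).
Context (iota : M -> N) (g : N -> 'M[R]_m).
Context (Gam : N -> 'Hom('rV[R]_m, 'End('rV[R]_m))).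

(* Injectively immersed submanifolds. *)
Definition submanifold : Prop :=
  [/\ smooth_map iota, injective iota & forall p, lker (dmap iota p) = 0%VS].

Definition TM (p : M) : {vspace 'rV[R]_m} := limg (dmap iota p).

Definition TMperp (p : M) : {vspace 'rV[R]_m} := orthv (g (iota p)) (TM p).

Definition RadTM (p : M) : {vspace 'rV[R]_m} := (TM p :&: TMperp p)%VS.

Definition null_submanifold (r : nat) : Prop :=
  [/\ submanifold, (0 < r)%N & smooth_distribution iota r RadTM].

(* The bundles S(TM), S(TM^perp) and ltr(TM), as subbundles of TN along M. *)
Record screen_data := ScreenData {
  scr : M -> {vspace 'rV[R]_m};
  scrperp : M -> {vspace 'rV[R]_m};
  ltr : M -> {vspace 'rV[R]_m}
}.

Context (B : screen_data).

Definition screen_distribution : Prop :=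
  (exists k, smooth_distribution iota k (scr B)) /\
  forall p, [/\ nondegenerate_on (g (iota p)) (scr B p),
                (RadTM p + scr B p = TM p)%VS
              & (RadTM p :&: scr B p = 0)%VS].

Definition screen_transversal : Prop :=
  (exists k, smooth_distribution iota k (scrperp B)) /\
  forall p, [/\ nondegenerate_on (g (iota p)) (scrperp B p),
                (RadTM p + scrperp B p = TMperp p)%VS
              & (RadTM p :&: scrperp B p = 0)%VS].

Definition null_transversal (r : nat) : Prop :=
  forall p, exists O : set M, exists xi Nn : 'I_r -> M -> 'rV[R]_m,
    [/\ open O, O p,
        forall k, smooth_along iota O (xi k) /\ smooth_along iota O (Nn k)
      & forall q, O q ->
        [/\ basis_of (RadTM q) (codom (xi ^~ q)),
            basis_of (ltr B q) (codom (Nn ^~ q)),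
            forall k, (Nn k q \in orthv (g (iota q)) (scr B q)) /\
                      (Nn k q \in orthv (g (iota q)) (scrperp B q)),
            forall k l, ip (g (iota q)) (xi k q) (Nn l q) = (k == l)%:R
          & forall k l, ip (g (iota q)) (Nn k q) (Nn l q) = 0]].

(* A_W x, minus the TM-component of nabla_x W in TN = TM (+) tr(TM). *)
Definition shape_op (W : M -> 'rV[R]_m) (p : M) (x : 'rV[R]_d) : 'rV[R]_m :=
  - daddv_pi (TM p) (ltr B p + scrperp B p)%VS (cov Gam iota W p x).

Definition rad_component (p : M) (w : 'rV[R]_m) : 'rV[R]_m :=
  daddv_pi (RadTM p) (scr B p) w.

Definition screen_section (X : M -> 'rV[R]_d) : Prop :=
  smooth_field setT X /\ forall p, dmap iota p (X p) \in scr B p.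

(* Integrability of a distribution is closure of its sections under the Lie
   bracket (complete integrability in the sense of Warner). *)
Definition screen_integrable : Prop :=
  forall X Y, screen_section X -> screen_section Y ->
  forall p, dmap iota p (bracket X Y p) \in scr B p.

End NullSubmanifolds.

Definition screen_real (R : realType) (n d : nat) (M : manifold R d)
    (N : manifold R (rdim n)) (C : contact_data N) (iota : M -> N)
    (g : N -> 'M[R]_(rdim n)) (B : screen_data (rdim n) M) : Prop :=
  forall (i : cover_index C) p, cover_set i (iota p) ->
    (charV i (iota p) <= scrperp B p)%VS /\
    forall a : 'I_3,
      (Jtens i a (iota p) @: RadTM iota g p = RadTM iota g p)%VS /\
      (Jtens i a (iota p) @: scr B p <= scrperp B p)%VS.

(* Main.v *)
(* On a normal complex contact manifold put, for horizontal x, y, z,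
   alpha_x(y,z) = g((nabla_x G)y, z) - sigma(x) g(Hy, z).  Evaluating d(du) = 0
   on horizontal vectors shows that the cyclic sum of alpha vanishes, and S = 0
   turns the Nijenhuis tensor of G into a second linear relation, in which sigma
   cancels; as in the proof that an integrable almost Kaehler structure is
   Kaehler, the two relations force alpha = 0.  The same argument for v, H and
   T, followed by H = GJ, gives nabla_x G, nabla_x H and nabla_x J modulo the
   characteristic bundle.

   For X, Y in S(TM), torsion-freeness now yields
   nabla_Y (J_a X) - nabla_X (J_a Y) = - J_a [X, Y] modulo S(TM^perp).  Since J_a
   maps S(TM) into S(TM^perp) and Rad TM isomorphically onto itself, the radical
   component in question is the image under - J_a of that of [X, Y]. *)

From HB Require Import structures.
Require Import Defs.
From mathcomp Require Import all_boot all_order all_algebra.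
From mathcomp Require Import boolp classical_sets functions reals topology.
From mathcomp Require Import normedtype landau derive.
From mathcomp Require Import ring lra.

Set Implicit Arguments.
Unset Strict Implicit.
Unset Printing Implicit Defensive.

Import Order.TTheory GRing.Theory Num.Theory.
Import numFieldNormedType.Exports.

Local Open Scope classical_set_scope.
Local Open Scope ring_scope.

(** * Calculus in normed spaces *)

Section Calculus.
Context {R : realType}.
Implicit Types V W : normedModType R.

(** Since a tangent vector at [q] is stored by its components in [chart q], and [chart q] need not
    vary continuously with [q], the raw values of a vector field cannot be differentiated. Every
    derivative is therefore taken after reading the field in one fixed chart. This produces second
    derivatives of transition maps and of [iota], which cancel by the symmetry of second
    derivatives. The sections [X] and [Y] live on [M] and are never extended to [N]: fields along
    [iota] are differentiated by the pulled back connection, and the ambient geometry enters through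
    the pointwise tensor [tensor_deriv]. The two linear relations force alpha = 0 because alpha is
    also skew in its last two arguments: beta(x; y, z) = alpha_{Gx}(y, z) then satisfies beta(x; y,
    z) + beta(y; z, x) = beta(z; x, y), and adding a cyclic permutation of this gives 2 beta(x; y,
    z) = 0. *)

Lemma near_eq_differentiable V W (f g : V -> W) (x : V) :
  (\near x, f x = g x) -> differentiable f x -> differentiable g x.
Proof.
move=> fg /diff_locallyP[df_cont df_eq].
have h : continuous ('d f x) /\
    g \o shift x = cst (g x) + 'd f x +o_ (0 : V) id.
  split=> //; rewrite -(nbhs_singleton fg).
  apply/eqaddoP => e e0.
  have /eqaddoP/(_ _ e0) := df_eq.
  have nfg : \forall y \near (0 : V), f (y + x) = g (y + x).
    by move: (fg); rewrite (near_shift 0 x) /= subr0.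
  move=> H; near=> y.
  have -> : (g \o shift x - (cst (f x) + 'd f x)) y =
            (f \o shift x - (cst (f x) + 'd f x)) y.
    by rewrite !fctE /=; congr (_ - _); apply/esym; near: y.
  by near: y.
have [h1 h2] := h.
have e := diff_unique h1 h2.
by apply/diff_locallyP; rewrite e.
Unshelve. all: by end_near. Qed.

Lemma derive_comp V V' W (phi : V -> V') (f : V' -> W) x v :
  differentiable phi x -> differentiable f (phi x) ->
  'D_v (f \o phi) x = 'D_('D_v phi x) f (phi x).
Proof.
move=> dphi df; rewrite !deriveE //; last exact: differentiable_comp.
by rewrite diff_comp.
Qed.

Lemma derive_linear V W (f : V -> W) x a v w : differentiable f x ->
  'D_(a *: v + w) f x = a *: 'D_v f x + 'D_w f x.
Proof. by move=> df; rewrite !deriveE // linearP. Qed.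

Lemma derive_sumr m W (f : 'rV[R]_m -> W) x v : differentiable f x ->
  'D_v f x = \sum_k v 0 k *: 'D_(delta_mx 0 k) f x.
Proof.
move=> df; rewrite deriveE // {1}[v]row_sum_delta linear_sum.
by apply: eq_bigr => k _; rewrite linearZ deriveE.
Qed.

Lemma derive_coord V m (f : V -> 'rV[R]_m) x v k : differentiable f x ->
  'D_v f x 0 k = 'D_v (fun y => f y 0 k : R^o) x.
Proof.
move=> df; rewrite derive_mx ?mxE //; exact: diff_derivable.
Qed.

Lemma differentiable_rV V m (f : V -> 'rV[R]_m) x :
  (forall k, differentiable (fun y => f y 0 k : R^o) x) <-> differentiable f x.
Proof.
split=> [df|df k]; last first.
  apply: (@differentiable_comp _ _ _ _ f (fun y : 'rV[R]_m => y 0 k : R^o)) => //.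
  exact: differentiable_coord.
rewrite (_ : f = \sum_k (fun y => f y 0 k *: delta_mx 0 k)); last first.
  by apply/funext => y; rewrite fct_sumE [LHS]row_sum_delta.
apply: differentiable_sum => k; exact: differentiableZl.
Qed.

Lemma deriveDE V W (f g : V -> W) x v :
  differentiable f x -> differentiable g x ->
  'D_v (fun y => f y + g y) x = 'D_v f x + 'D_v g x.
Proof.
by move=> df dg; rewrite -deriveD //; apply: diff_derivable.
Qed.

Lemma deriveME V (f g : V -> R^o) x v :
  differentiable f x -> differentiable g x ->
  'D_v (fun y => f y * g y : R^o) x = 'D_v f x * g x + f x * 'D_v g x.
Proof.
move=> df dg; rewrite [LHS](deriveM (diff_derivable df) (diff_derivable dg)).
by rewrite addrC mulrC.
Qed.

Lemma derive_sumE V W n (f : 'I_n -> V -> W) x v :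
  (forall k, differentiable (f k) x) ->
  'D_v (fun y => \sum_k f k y) x = \sum_k 'D_v (f k) x.
Proof.
move=> df; rewrite -derive_sum; last by move=> k; apply: diff_derivable.
by congr ('D_v _ x); apply/funext => y; rewrite fct_sumE.
Qed.

Lemma differentiable_sumE V W n (f : 'I_n -> V -> W) x :
  (forall k, differentiable (f k) x) ->
  differentiable (fun y => \sum_k f k y) x.
Proof.
move=> df; rewrite (_ : (fun y => _) = \sum_k f k); last first.
  by apply/funext => y; rewrite fct_sumE.
exact: differentiable_sum.
Qed.

End Calculus.

(** * Calculus of the classes [Ck] *)

Section CkTheory.
Context {R : realType}.
Implicit Types V W : normedModType R.

Lemma Ck_ext V W k (A : set V) (f g : V -> W) : open A ->
  (forall x, A x -> f x = g x) -> Ck k A f -> Ck k A g.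
Proof.
move=> oA; elim: k f g => [|k IH] f g fg /=.
  move=> cf x Ax; have h : f @ x --> f x by exact: cf.
  suff : g @ x --> g x by [].
  rewrite -(fg x Ax); apply: cvg_trans h; apply: near_eq_cvg; near=> y; apply: fg; near: y.
  exact: open_nbhs_nbhs.
have nr x : A x -> \near x, f x = g x.
  by move=> Ax; near=> y; apply: fg; near: y; exact: open_nbhs_nbhs.
move=> [df cf]; split=> [x Ax|v]; first exact: near_eq_differentiable (nr x Ax) (df x Ax).
by apply: IH (cf v) => x Ax; apply: near_eq_derive; exact: nr.
Unshelve. all: by end_near. Qed.

Lemma Ck_sub V W k (A B : set V) (f : V -> W) :
  A `<=` B -> Ck k B f -> Ck k A f.
Proof.
move=> AB; elim: k f => [|k IH] f /=; first by move=> h x /AB/h.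
by move=> [df cf]; split=> [x /AB/df//|v]; apply/IH/cf.
Qed.

Lemma CkS V W k (A : set V) (f : V -> W) : Ck k.+1 A f -> Ck k A f.
Proof.
elim: k f => [|k IH] f.
  by move=> [df _] x Ax; apply/differentiable_continuous/df.
by move=> [df cf]; split=> // v; apply/IH/cf.
Qed.

Lemma Ck_cst V W k (A : set V) (c : W) : Ck k A (fun=> c).
Proof.
elim: k c => [|k IH] c /=; first by move=> x _; exact: cst_continuous.
split=> [x _|v]; first exact: differentiable_cst.
rewrite (_ : 'D_v _ = fun=> 0); first exact: IH.
by apply/funext => x; exact: derive_cst.
Qed.

Lemma CkD V W k (A : set V) (f g : V -> W) : open A ->
  Ck k A f -> Ck k A g -> Ck k A (fun x => f x + g x).
Proof.
move=> oA; elim: k f g => [|k IH] f g /=.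
  by move=> cf cg x Ax; apply: continuousD; [exact: cf|exact: cg].
move=> [df cf] [dg cg]; split=> [x Ax|v].
  by apply: differentiableD; [exact: df|exact: dg].
apply: Ck_ext (IH _ _ (cf v) (cg v)) => // x Ax.
by rewrite deriveDE //; [exact: df|exact: dg].
Qed.

Lemma CkM V k (A : set V) (f g : V -> R^o) : open A ->
  Ck k A f -> Ck k A g -> Ck k A (fun x => f x * g x : R^o).
Proof.
move=> oA; elim: k f g => [|k IH] f g.
  by move=> cf cg x Ax; apply: continuousM; [exact: cf|exact: cg].
move=> cf1 cg1; have [df cf] := cf1; have [dg cg] := cg1.
split=> [x Ax|v]; first by apply: differentiableM; [exact: df|exact: dg].
apply: (@Ck_ext _ _ _ _ (fun x => 'D_v f x * g x + f x * 'D_v g x)) => //.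
  by move=> x Ax; rewrite deriveME //; [exact: df|exact: dg].
by apply: CkD => //; apply: IH; first [exact: cf|exact: cg|exact: CkS].
Qed.

Lemma Ck_sum V W k n (A : set V) (f : 'I_n -> V -> W) : open A ->
  (forall l, Ck k A (f l)) -> Ck k A (fun x => \sum_l f l x).
Proof.
move=> oA; elim: n f => [|n IH] f cf.
  by rewrite (_ : (fun x => _) = fun=> 0); [exact: Ck_cst|apply/funext => x; rewrite big_ord0].
rewrite (_ : (fun x => _) = fun x => f ord0 x + \sum_l f (lift ord0 l) x).
  by apply: CkD => //; apply: IH => l; exact: cf.
by apply/funext => x; rewrite big_ord_recl.
Qed.

Lemma Ck_coord V m k (A : set V) (f : V -> 'rV[R]_m) : open A ->
  Ck k A f <-> forall l, Ck k A (fun x => f x 0 l : R^o).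
Proof.
move=> oA; elim: k f => [|k IH] f /=.
  split=> [cf l x Ax|cf x Ax].
    apply: (@continuous_comp _ _ _ f (fun y : 'rV[R]_m => y 0 l : R^o)); first exact: cf.
    exact: coord_continuous.
  rewrite (_ : f = fun y => \sum_l f y 0 l *: delta_mx 0 l); last first.
    by apply/funext => y; rewrite [LHS]row_sum_delta.
  apply: (@Ck_sum _ _ 0 _ A (fun l y => f y 0 l *: delta_mx 0 l)) Ax => // l y Ay.
  by apply: cvgZr_tmp; exact: cf.
split=> [[df cf] l|cf].
  split=> [x Ax|v]; first by move/differentiable_rV: (df x Ax).
  apply: Ck_ext (((IH _).1 (cf v)) l) => // x Ax.
  by rewrite derive_coord //; exact: df.
have df x : A x -> differentiable f x.
  by move=> Ax; apply/differentiable_rV => l; have [d _] := cf l; exact: d.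
split=> // v; apply/IH => l; have [_ d] := cf l.
by apply: Ck_ext (d v) => // x Ax; rewrite derive_coord //; exact: df.
Qed.

(** By the chain rule the derivative is taken in the direction ['D_v phi x], which moves with [x];
    expanding it in the standard basis gives a sum of products of functions one class lower. Hence
    row vectors as the source of [f], for the finite basis, and scalars as its target, for [CkM]. *)
Lemma Ck_comp_scalar V m k (A : set V) (B : set 'rV[R]_m) (phi : V -> 'rV[R]_m)
    (f : 'rV[R]_m -> R^o) : open A -> phi @` A `<=` B ->
  Ck k A phi -> Ck k B f -> Ck k A (f \o phi).
Proof.
move=> oA AB; have AB' x : A x -> B (phi x) by move=> Ax; apply: AB; exists x.
elim: k f => [|k IH] f.
  move=> cp cf x Ax; apply: continuous_comp; first exact: cp.
  by apply: cf; exact: AB'.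
move=> cp1 [df cf]; have [dp cp] := cp1.
split=> [x Ax|v]; first by apply: differentiable_comp; [exact: dp|exact/df/AB'].
apply: (@Ck_ext _ _ _ _
   (fun x => \sum_l 'D_v phi x 0 l * ('D_(delta_mx 0 l) f \o phi) x : R^o)) => //.
  move=> x Ax; rewrite (@derive_comp _ _ _ _ phi f); [|exact: dp|exact/df/AB'].
  by rewrite [RHS]derive_sumr //; exact/df/AB'.
apply: Ck_sum => // l; apply: CkM => //.
  exact: (((Ck_coord _ _ oA).1 (cp v)) l).
by apply: IH; [exact: CkS|exact: cf].
Qed.

End CkTheory.

(** * Symmetry of second derivatives *)

Section Schwarz.
Context {R : realType} {V : normedModType R}.
Implicit Types (f : V -> R^o) (x v w : V) (A : set V).

Lemma is_derive_line f x v (s : R) : differentiable f (x + s *: v) ->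
  is_derive s 1 (fun t : R => f (x + t *: v)) ('D_v f (x + s *: v)).
Proof.
move=> df; pose L (t : R) := x + t *: v.
have dL : differentiable L s.
  apply: differentiableD; first exact: differentiable_cst.
  exact: differentiableZl.
have e : 'D_1 L s = v.
  rewrite deriveDE; [|exact: differentiable_cst|exact: differentiableZl].
  rewrite derive_cst add0r deriveE; last exact: differentiableZl.
  by rewrite diffZl // diff_val scale1r.
apply: DeriveDef.
  by apply: diff_derivable; apply: (@differentiable_comp _ _ _ _ L f).
by rewrite (@derive_comp _ _ _ _ L f) // e.
Qed.

(** The mean value theorem is used twice: along [v] for the increment of [f] in the direction [w],
    then along [w] for ['D_v f]. *)
Lemma second_difference f A x v w (t : R) : 0 < t ->
  (forall a b, 0 <= a <= t -> 0 <= b <= t -> A (x + a *: v + b *: w)) ->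
  Ck 2 A f ->
  exists a b, [/\ 0 <= a <= t, 0 <= b <= t &
    f (x + t *: v + t *: w) - f (x + t *: v) - f (x + t *: w) + f x =
    t ^+ 2 * 'D_w ('D_v f) (x + a *: v + b *: w)].
Proof.
move=> t0 hA [df cf].
have t0t : 0 <= t <= t by rewrite lexx ltW.
have z0t : (0 : R) <= (0 : R) <= t by rewrite lexx ltW.
pose phi (s : R) : R^o := f ((x + t *: w) + s *: v) - f (x + s *: v).
have dphi (s : R) : 0 <= s <= t ->
    is_derive s 1 phi ('D_v f (x + s *: v + t *: w) - 'D_v f (x + s *: v)).
  move=> hs; apply: is_deriveB.
    have -> : x + s *: v + t *: w = (x + t *: w) + s *: v by rewrite addrAC.
    apply: is_derive_line; apply: df; rewrite addrAC; exact: hA.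
  apply: is_derive_line; apply: df; rewrite -[x + _]addr0 -(scale0r w); exact: hA.
have [s hs||a ha ea] := @MVT_segment _ phi
    (fun s => 'D_v f (x + s *: v + t *: w) - 'D_v f (x + s *: v)) 0 t (ltW t0).
- by apply: dphi; move: hs; rewrite in_itv /= => /andP[/ltW-> /ltW->].
- apply: derivable_within_continuous => s; rewrite in_itv /= => hs.
  by have [] := dphi s hs.
have {}ha : 0 <= a <= t by move: ha; rewrite in_itv.
have dpsi (s : R) : 0 <= s <= t ->
    is_derive s 1 (fun b : R => 'D_v f (x + a *: v + b *: w))
      ('D_w ('D_v f) (x + a *: v + s *: w)).
  move=> hs; apply: is_derive_line; have [d _] := cf v; apply: d; exact: hA.
have [s hs||b hb eb] := @MVT_segment _ (fun b : R => 'D_v f (x + a *: v + b *: w))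
    (fun s => 'D_w ('D_v f) (x + a *: v + s *: w)) 0 t (ltW t0).
- by apply: dpsi; move: hs; rewrite in_itv /= => /andP[/ltW-> /ltW->].
- apply: derivable_within_continuous => s; rewrite in_itv /= => hs.
  by have [] := dpsi s hs.
have {}hb : 0 <= b <= t by move: hb; rewrite in_itv.
exists a, b; split=> //.
move: ea eb; rewrite /phi !scale0r !addr0 !subr0 => ea eb.
rewrite expr2 -mulrA [t * 'D_w _ _]mulrC -eb mulrC -ea.
by rewrite [x + t *: w + _]addrAC opprB addrA [RHS]addrAC.
Qed.

(** The second difference is symmetric in [v] and [w], so the two mixed derivatives take a common
    value, each at some point of a small parallelogram; continuity carries this to [x]. *)
Lemma derive_swap f A x v w : open A -> A x -> Ck 2 A f ->
  'D_w ('D_v f) x = 'D_v ('D_w f) x.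
Proof.
move=> oA Ax cf.
have [_ cf1] := cf.
have c1 : {for x, continuous ('D_w ('D_v f))} by have [_ c] := cf1 v; exact: c.
have c2 : {for x, continuous ('D_v ('D_w f))} by have [_ c] := cf1 w; exact: c.
apply/eqP; rewrite -subr_eq0 -normr_le0; apply/ler_addgt0Pl => e e0.
rewrite addr0.
have e20 : 0 < e / 2 by rewrite divr_gt0.
have /cvgrPdist_lt/(_ _ e20) n1 := c1.
have /cvgrPdist_lt/(_ _ e20) n2 := c2.
have : \forall y \near x, [/\ A y, `|'D_w ('D_v f) x - 'D_w ('D_v f) y| < e / 2
    & `|'D_v ('D_w f) x - 'D_v ('D_w f) y| < e / 2].
  have nA : nbhs x A by exact: open_nbhs_nbhs.
  exact: filterS3 (fun y a b c => And3 a b c) nA n1 n2.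
move=> /nbhs_normP[r /= r0 hr].
pose s := `|v| + `|w|; have s0 : 0 <= s by rewrite addr_ge0.
(* The summand 1 keeps the quotient defined when [v = w = 0] and makes the parallelogram fit
   strictly inside the ball of radius [r]. *)
pose t := r / (s + 1).
have s10 : 0 < s + 1 by rewrite ltr_wpDl.
have t0 : 0 < t by rewrite divr_gt0.
have tr : t * s < r.
  by rewrite /t mulrAC ltr_pdivrMr // ltr_pM2l // ltrDl.
have hB v' w' : s = `|v'| + `|w'| -> forall a b, 0 <= a <= t -> 0 <= b <= t ->
    `|x - (x + a *: v' + b *: w')| < r.
  move=> es a b /andP[a0 at_] /andP[b0 bt].
  rewrite -addrA opprD addNKr normrN (le_lt_trans (ler_normD _ _)) //.
  rewrite !normrZ !ger0_norm // (le_lt_trans _ tr) // es mulrDr.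
  by rewrite lerD // ler_wpM2r.
have cB : Ck 2 [set y | `|x - y| < r] f.
  by apply: Ck_sub cf => y /hr[].
have [a [b [ha hb e1]]] := second_difference t0 (hB v w erefl) cB.
have [a' [b' [ha' hb' e2]]] := second_difference t0 (hB w v (addrC _ _)) cB.
have [_ d1 _] := hr _ (hB v w erefl a b ha hb).
have [_ _ d2] := hr _ (hB w v (addrC _ _) a' b' ha' hb').
have e12 : 'D_w ('D_v f) (x + a *: v + b *: w) =
    'D_v ('D_w f) (x + a' *: w + b' *: v).
  have t20 : t ^+ 2 != 0 by rewrite expf_neq0 // gt_eqF.
  apply: (mulfI t20); rewrite -[LHS]e1 -[RHS]e2 (addrAC x (t *: w)).
  by congr (_ + _); exact: addrAC.
rewrite -(subrKA ('D_w ('D_v f) (x + a *: v + b *: w))).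
apply: le_trans (ler_normD _ _) _; rewrite (splitr e).
by apply: lerD; apply: ltW; [exact: d1|rewrite e12 distrC; exact: d2].
Unshelve. all: by end_near. Qed.

Lemma derive_swap_rV m (f : V -> 'rV[R]_m) A x v w : open A -> A x -> Ck 2 A f ->
  'D_w ('D_v f) x = 'D_v ('D_w f) x.
Proof.
move=> oA Ax cf; have [df cdf] := cf; apply/rowP => k.
have h u z : ('D_z ('D_u f) x) 0 k = 'D_z ('D_u (fun y => f y 0 k : R^o)) x.
  rewrite derive_coord; last by have [d _] := cdf u; exact: d.
  apply: near_eq_derive; near=> y; apply: derive_coord; apply: df.
  by near: y; exact: open_nbhs_nbhs.
have ck := (Ck_coord 2 f oA).1 cf k.
have hs := derive_swap v w oA Ax ck.
exact: etrans (h v w) (etrans hs (esym (h w v))).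
Unshelve. all: by end_near. Qed.

End Schwarz.

(** * Charts and smooth fields *)

Section Charts.
Context {R : realType} {d : nat} {M : manifold R d}.
Implicit Types (p q : M) (O : set M) (W : normedModType R).

Definition cimg p O : set 'rV[R]_d := chart p @` (dom p `&` O).

Lemma cimgP p O x : cimg p O x ->
  [/\ dom p (chartV p x), O (chartV p x) & chart p (chartV p x) = x].
Proof. by move=> [q [dq Oq] <-]; rewrite chartK. Qed.

Lemma cimg_mem p O q : dom p q -> O q -> cimg p O (chart p q).
Proof. by exists q. Qed.

Lemma cimg_sub p O O' : O `<=` O' -> cimg p O `<=` cimg p O'.
Proof. by move=> h x [q [dq Oq] <-]; exists q => //; split=> //; exact: h. Qed.

Lemma cimg_open p O : open O -> open (cimg p O).
Proof.
move=> oO; rewrite openE => x [q [dq Oq] exq].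
have nx : nbhs x (chart p @` dom p).
  by apply: open_nbhs_nbhs; split; [exact: chart_open|exists q].
have cV : chartV p @ x --> chartV p x.
  by apply: chartV_continuous; exists q.
have nO : nbhs (chartV p x) O.
  by apply: open_nbhs_nbhs; split => //; rewrite -exq chartK.
have nV := cV _ nO.
apply: filterS2 nx nV => y [s ds es] hs.
by exists s => //; split=> //; move: hs; rewrite /= -es chartK.
Qed.

Lemma transition_smooth_cimg p q : Cinf (cimg p (dom q)) (chart q \o chartV p).
Proof. exact: transition_smooth. Qed.

Lemma transition_differentiable p q x : cimg p (dom q) x ->
  differentiable (chart q \o chartV p) x.
Proof. by move=> hx; have [h _] := transition_smooth_cimg p q 1; exact: h. Qed.

Lemma smooth_on_Ck W O (f : M -> W) p k : smooth_on O f ->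
  Ck k (cimg p O) (f \o chartV p).
Proof. by move=> h; exact: h. Qed.

Lemma smooth_on_diff W O (f : M -> W) p q : smooth_on O f -> O q -> dom p q ->
  differentiable (f \o chartV p) (chart p q).
Proof.
move=> h Oq dq; have [h1 _] := smooth_on_Ck p 1 h.
by apply: h1; exact: cimg_mem.
Qed.

Lemma smooth_on_sub W O O' (f : M -> W) : O `<=` O' ->
  smooth_on O' f -> smooth_on O f.
Proof. by move=> h hf p k; apply: Ck_sub (hf p k); exact: cimg_sub. Qed.

Lemma smooth_on_ext W O (f h : M -> W) : open O -> (forall q, O q -> f q = h q) ->
  smooth_on O f -> smooth_on O h.
Proof.
move=> oO e hf p k; apply: Ck_ext (hf p k); first exact: cimg_open.
by move=> x /cimgP[_ Ox _]; exact: e.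
Qed.

Lemma smooth_on_cst W O (c : W) : smooth_on O (fun=> c).
Proof. by move=> p k; exact: Ck_cst. Qed.

Lemma smooth_onD W O (f h : M -> W) : open O -> smooth_on O f -> smooth_on O h ->
  smooth_on O (fun q => f q + h q).
Proof.
move=> oO hf hh p k; apply: (CkD (f := f \o chartV p)); first exact: cimg_open.
  exact: hf.
exact: hh.
Qed.

Lemma smooth_onM O (f h : M -> R^o) : open O -> smooth_on O f -> smooth_on O h ->
  smooth_on O (fun q => f q * h q : R^o).
Proof.
move=> oO hf hh p k; apply: (CkM (f := f \o chartV p)); first exact: cimg_open.
  exact: hf.
exact: hh.
Qed.

Lemma smooth_on_sum W O n (f : 'I_n -> M -> W) : open O ->
  (forall l, smooth_on O (f l)) -> smooth_on O (fun q => \sum_l f l q).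
Proof.
move=> oO hf p k; apply: (Ck_sum (f := fun l => f l \o chartV p)).
  exact: cimg_open.
by move=> l; exact: hf.
Qed.

Lemma smooth_on_coord O m (f : M -> 'rV[R]_m) : open O ->
  smooth_on O f <-> forall l, smooth_on O (fun q => f q 0 l : R^o).
Proof.
move=> oO; split=> [h l p k|h p k].
  exact: (Ck_coord k (f \o chartV p) (cimg_open oO)).1 (h p k) l.
by apply/(Ck_coord k (f \o chartV p) (cimg_open (p := p) oO)) => l; exact: (h l p k).
Qed.

Lemma smooth_onZ O m (c : M -> R^o) (f : M -> 'rV[R]_m) : open O ->
  smooth_on O c -> smooth_on O f -> smooth_on O (fun q => c q *: f q).
Proof.
move=> oO hc /(smooth_on_coord _ oO) hf; apply/smooth_on_coord => // l.
apply: (smooth_on_ext (f := fun q => c q * f q 0 l)) => //.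
  by move=> q _; rewrite mxE.
exact: smooth_onM.
Qed.

Lemma smooth_on_linear O m m' (L : 'Hom('rV[R]_m, 'rV[R]_m')) (f : M -> 'rV[R]_m) :
  open O -> smooth_on O f -> smooth_on O (fun q => L (f q)).
Proof.
move=> oO /(smooth_on_coord _ oO) hf.
apply: (smooth_on_ext (f := fun q => \sum_k f q 0 k *: L (delta_mx 0 k))) => //.
  by move=> q _; rewrite {2}[f q]row_sum_delta linear_sum; apply: eq_bigr => k _; rewrite linearZ.
by apply: smooth_on_sum => // k; apply: smooth_onZ => //; exact: smooth_on_cst.
Qed.

(** Any other reading of [f] is the given one composed with a transition map. *)
Lemma smooth_on_chart p O (f : M -> R^o) : open O -> O `<=` dom p ->
  Cinf (cimg p O) (f \o chartV p) -> smooth_on O f.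
Proof.
move=> oO Od hf q k.
apply: (@Ck_ext _ _ _ _ _ ((f \o chartV p) \o (chart p \o chartV q))).
- exact: cimg_open.
- by move=> x /cimgP[_ Ox _] /=; rewrite chartK //; exact: Od.
apply: (@Ck_comp_scalar _ _ _ _ _ (cimg p O)); first exact: cimg_open.
- by move=> _ [x /cimgP[_ Ox _] <-]; apply: cimg_mem => //; exact: Od.
- by apply: Ck_sub (transition_smooth_cimg q p k); exact: cimg_sub.
- exact: hf.
Qed.

Lemma near_chart p q O : open O -> O q -> dom p q -> nbhs (chart p q) (cimg p O).
Proof.
move=> oO Oq dq; apply: open_nbhs_nbhs; split; first exact: cimg_open.
exact: cimg_mem.
Qed.

Lemma derive_chart_ext W O (f h : M -> W) p q v : open O -> O q -> dom p q ->
  (forall s, O s -> f s = h s) ->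
  'D_v (f \o chartV p) (chart p q) = 'D_v (h \o chartV p) (chart p q).
Proof.
move=> oO Oq dq e; apply: near_eq_derive.
apply: filterS (near_chart oO Oq dq) => x /cimgP[_ Ox _]; exact: e.
Qed.

Lemma derive_change_chart W (f : M -> W) p q q' v : dom p q -> dom q' q ->
  differentiable (f \o chartV p) (chart p q) ->
  'D_v (f \o chartV q') (chart q' q) =
  'D_('D_v (chart p \o chartV q') (chart q' q)) (f \o chartV p) (chart p q).
Proof.
move=> dq dq' df.
have e : 'D_v (f \o chartV q') (chart q' q) =
    'D_v ((f \o chartV p) \o (chart p \o chartV q')) (chart q' q).
  apply: near_eq_derive.
  apply: filterS (near_chart (dom_open p) dq dq') => x /cimgP[_ dx _] /=.
  by rewrite chartK.
rewrite e (@derive_comp _ _ _ _ (chart p \o chartV q') (f \o chartV p)) /= ?chartK //.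
by apply: transition_differentiable; exact: cimg_mem.
Qed.

Lemma dirder_chart W (f : M -> W) p q x : dom p q ->
  differentiable (f \o chartV p) (chart p q) ->
  dirder q x f = 'D_(dirder q x (chart p)) (f \o chartV p) (chart p q).
Proof. by move=> dq df; apply: derive_change_chart => //; exact: dom_mem. Qed.

Lemma derive_chart_id p q v : dom p q ->
  'D_v (chart p \o chartV p) (chart p q) = v.
Proof.
move=> dq; rewrite -[RHS](derive_id (chart p q) v); apply: near_eq_derive.
by apply: filterS (near_chart (dom_open p) dq dq) => x /cimgP[].
Qed.

Lemma dirder_cfield W (f : M -> W) p q v : dom p q ->
  differentiable (f \o chartV q) (chart q q) ->
  dirder q (cfield p v q) f = 'D_v (f \o chartV p) (chart p q).
Proof.
by move=> dq df; rewrite (derive_change_chart v (dom_mem q) dq df).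
Qed.

Lemma chart_diff p q q' : dom p q -> dom q' q ->
  differentiable (chart p \o chartV q') (chart q' q).
Proof. by move=> dq dq'; apply: transition_differentiable; exact: cimg_mem. Qed.

(** Together with [cfield_chart]: the changes of components from [chart p] to [chart q] and back are
    mutually inverse. *)
Lemma chart_cfield p q v : dom p q -> dirder q (cfield p v q) (chart p) = v.
Proof.
move=> dq; rewrite dirder_cfield //; first exact: derive_chart_id.
by apply: chart_diff => //; exact: dom_mem.
Qed.

Lemma cfield_chart p q x : dom p q -> cfield p (dirder q x (chart p)) q = x.
Proof.
move=> dq; rewrite /cfield -(@dirder_chart _ (chart q)) //.
  by apply: derive_chart_id; exact: dom_mem.
by apply: chart_diff => //; exact: dom_mem.
Qed.

Lemma dirder_chart_self p x : dirder p x (chart p) = x.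
Proof. by apply: derive_chart_id; exact: dom_mem. Qed.

Lemma cfield_self p v : cfield p v p = v.
Proof. by apply: derive_chart_id; exact: dom_mem. Qed.

Lemma dirder_linear W (f : M -> W) p a x y :
  differentiable (f \o chartV p) (chart p p) ->
  dirder p (a *: x + y) f = a *: dirder p x f + dirder p y f.
Proof. by move=> df; exact: derive_linear. Qed.

Lemma cfield_sum p q v : dom p q ->
  cfield p v q = \sum_k v 0 k *: cfield p (delta_mx 0 k) q.
Proof.
by move=> dq; apply: derive_sumr; apply: chart_diff => //; exact: dom_mem.
Qed.

End Charts.

(** * Smooth vector fields *)

Section Fields.
Context {R : realType} {d : nat} {M : manifold R d}.
Implicit Types (p q : M) (O : set M) (X Y : M -> 'rV[R]_d).

Lemma smooth_field_sub O O' X : O `<=` O' -> smooth_field O' X -> smooth_field O X.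
Proof. by move=> h hX y; apply: smooth_on_sub (hX y) => q [/h]. Qed.

Lemma smooth_field_coord O X p : smooth_field O X -> O `<=` dom p ->
  smooth_on O (fun q => dirder q (X q) (chart p)).
Proof. by move=> h Od; apply: smooth_on_sub (h p) => q Oq; split=> //; exact: Od. Qed.

(** The components in [chart y] are those in [chart p] multiplied by the Jacobian matrix of the
    transition map, whose entries are smooth. *)
Lemma smooth_field_chart O X p : open O -> O `<=` dom p ->
  smooth_on O (fun q => dirder q (X q) (chart p)) -> smooth_field O X.
Proof.
move=> oO Od hX y.
have oy : open (O `&` dom y) by apply: openI => //; exact: dom_open.
have Oy : O `&` dom y `<=` dom p by move=> q [/Od].
apply: (smooth_on_ext (f := fun q => \sum_k dirder q (X q) (chart p) 0 k *:
    'D_(delta_mx 0 k) (chart y \o chartV p) (chart p q))) => //.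
  move=> q [Oq dq]; have dpq := Od q Oq.
  rewrite [RHS](@dirder_chart _ _ _ _ _ p) //; last exact: chart_diff.
  by rewrite [RHS]derive_sumr //; exact: chart_diff.
apply: smooth_on_sum => // k; apply: smooth_onZ => //.
  move: k; apply/smooth_on_coord => //.
  by apply: smooth_on_sub hX => q [].
apply/smooth_on_coord => // l; apply: (smooth_on_chart (p := p)) => // j.
apply: (@Ck_ext _ _ _ _ _ (fun x => 'D_(delta_mx 0 k) (chart y \o chartV p) x 0 l)).
- exact: cimg_open.
- by move=> x /cimgP[_ _ /= ->].
apply: ((Ck_coord j _ (cimg_open oy)).1 _ l).
have [_ h] := @transition_smooth_cimg _ _ M p y j.+1.
by apply: Ck_sub (h _); apply: cimg_sub => q [].
Qed.

Lemma smooth_cfield O p v : open O -> O `<=` dom p -> smooth_field O (cfield p v).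
Proof.
move=> oO Od; apply: (smooth_field_chart (p := p)) => //.
apply: (smooth_on_ext (f := fun=> v)) => //; last exact: smooth_on_cst.
by move=> q Oq; rewrite chart_cfield //; exact: Od.
Qed.

Lemma smooth_fieldD O X Y : open O -> smooth_field O X -> smooth_field O Y ->
  smooth_field O (fun q => X q + Y q).
Proof.
move=> oO hX hY y; have oy : open (O `&` dom y) by apply: openI => //; exact: dom_open.
apply: (smooth_on_ext (f := fun q => dirder q (X q) (chart y) + dirder q (Y q) (chart y))) => //.
  move=> q [Oq dq]; rewrite -[X q]scale1r dirder_linear ?scale1r //.
  by apply: chart_diff => //; exact: dom_mem.
by apply: smooth_onD; [exact: oy|exact: hX|exact: hY].
Qed.

Lemma smooth_fieldZ O (c : M -> R^o) X : open O -> smooth_on O c -> smooth_field O X ->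
  smooth_field O (fun q => c q *: X q).
Proof.
move=> oO hc hX y; have oy : open (O `&` dom y) by apply: openI => //; exact: dom_open.
apply: (smooth_on_ext (f := fun q => c q *: dirder q (X q) (chart y))) => //.
  move=> q [Oq dq]; have df : differentiable (chart y \o chartV q) (chart q q).
    by apply: chart_diff => //; exact: dom_mem.
  by rewrite [RHS]deriveE // linearZ -deriveE.
apply: smooth_onZ; [exact: oy| |exact: hX].
by apply: smooth_on_sub hc => q [].
Qed.

End Fields.

(** * Connections and tensors along maps *)

Section InnerProduct.
Context {R : realType} {m : nat} (B : 'M[R]_m).
Implicit Types x y z : 'rV[R]_m.

Lemma ipDl x y z : ip B (x + y) z = ip B x z + ip B y z.
Proof. by rewrite /ip !mulmxDl mxE. Qed.
Lemma ipDr x y z : ip B x (y + z) = ip B x y + ip B x z.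
Proof. by rewrite /ip linearD mulmxDr mxE. Qed.
Lemma ipZl a x z : ip B (a *: x) z = a * ip B x z.
Proof. by rewrite /ip -!scalemxAl mxE. Qed.
Lemma ipZr a x z : ip B x (a *: z) = a * ip B x z.
Proof. by rewrite /ip linearZ -scalemxAr mxE. Qed.
Lemma ipNl x z : ip B (- x) z = - ip B x z.
Proof. by rewrite -scaleN1r ipZl mulN1r. Qed.
Lemma ipNr x z : ip B x (- z) = - ip B x z.
Proof. by rewrite -scaleN1r ipZr mulN1r. Qed.
Lemma ip0l z : ip B 0 z = 0.
Proof. by rewrite -(scale0r 0) ipZl mul0r. Qed.
Lemma ip0r z : ip B z 0 = 0.
Proof. by rewrite -(scale0r 0) ipZr mul0r. Qed.
Lemma ipC x y : B^T = B -> ip B x y = ip B y x.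
Proof.
move=> sB; rewrite /ip; set a := x *m B *m y^T.
have -> : y *m B *m x^T = a^T by rewrite !trmx_mul trmxK sB mulmxA.
by rewrite [a^T _ _]mxE.
Qed.

Lemma ip_nondegenerate x : B \in unitmx -> (forall z, ip B x z = 0) -> x = 0.
Proof.
move=> uB h; have e : x *m B = 0.
  apply/rowP => k; rewrite [RHS]mxE -[RHS](h (delta_mx 0 k)) /ip [RHS]mxE.
  have ed j : (delta_mx 0 k : 'rV[R]_m)^T j 0 = (j == k)%:R.
    by rewrite !mxE eqxx eq_sym.
  under eq_bigr => j _ do rewrite [X in _ * X](ed j).
  rewrite (bigD1 k) //= big1 ?addr0; first by rewrite eqxx mulr1.
  by move=> j /negPf ->; rewrite mulr0.
by rewrite -(mulmxK uB x) e mul0mx.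
Qed.

End InnerProduct.

(** Evaluates [linfun] on functions whose linearity is a proved fact and not a canonical structure;
    for [dmap] that fact comes from differentiability. *)
Lemma linfun_val (R : realType) (m : nat) (W : vectType R) (f : 'rV[R]_m -> W) x :
  linear f -> linfun f x = f x.
Proof.
move=> lf; pose L := GRing.isLinear.Build R 'rV[R]_m W *:%R _ lf.
pose h : {linear 'rV[R]_m -> W} := HB.pack f L.
exact: (lfunE h).
Qed.

Lemma derive_scale (R : realType) (V : normedModType R) m (c : V -> R^o)
    (f : V -> 'rV[R]_m) x v : differentiable c x -> differentiable f x ->
  differentiable (fun y => c y *: f y) x /\
  'D_v (fun y => c y *: f y) x = 'D_v c x *: f x + c x *: 'D_v f x.
Proof.
move=> dc /differentiable_rV df.
have d : differentiable (fun y => c y *: f y) x.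
  apply/differentiable_rV => k.
  rewrite (_ : (fun y => _) = (fun y => c y * f y 0 k : R^o)).
    exact: differentiableM.
  by apply/funext => y; rewrite mxE.
split=> //; apply/rowP => k; rewrite derive_coord //.
rewrite (_ : (fun y => _) = (fun y => c y * f y 0 k : R^o)).
  rewrite deriveME // !mxE derive_coord //; exact/differentiable_rV.
by apply/funext => y; rewrite mxE.
Qed.

Section DirectionalDerivatives.
Context {R : realType} {d : nat} {M : manifold R d}.
Implicit Types (p q : M) (O : set M) (W : normedModType R).

Lemma smooth_on_diff_self W O (f : M -> W) p : smooth_on O f -> O p ->
  differentiable (f \o chartV p) (chart p p).
Proof. by move=> hf Op; apply: (smooth_on_diff hf Op); exact: dom_mem. Qed.

Lemma dirder_ext W O (f h : M -> W) p x : open O -> O p ->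
  (forall q, O q -> f q = h q) -> dirder p x f = dirder p x h.
Proof. by move=> oO Op; apply: derive_chart_ext oO Op (dom_mem p). Qed.

Lemma dirderD W O (f h : M -> W) p x : O p -> smooth_on O f -> smooth_on O h ->
  dirder p x (fun q => f q + h q) = dirder p x f + dirder p x h.
Proof.
move=> Op hf hh; apply: (deriveDE (f := f \o chartV p)).
  exact: smooth_on_diff_self hf Op.
exact: smooth_on_diff_self hh Op.
Qed.

Lemma dirderM O (f h : M -> R^o) p x : O p -> smooth_on O f -> smooth_on O h ->
  dirder p x (fun q => f q * h q : R^o) = dirder p x f * h p + f p * dirder p x h.
Proof.
move=> Op hf hh; rewrite {1}/dirder (deriveME (f := f \o chartV p)).
- by rewrite /= (chartK (dom_mem p)).
- exact: smooth_on_diff_self hf Op.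
- exact: smooth_on_diff_self hh Op.
Qed.

Lemma dirder_cst W p x (c : W) : dirder p x (fun=> c) = 0.
Proof. exact: derive_cst. Qed.

Lemma dirderN O (f : M -> R^o) p x : O p -> smooth_on O f ->
  dirder p x (fun q => - f q : R^o) = - dirder p x f.
Proof.
move=> Op hf; have -> : (fun q => - f q : R^o) = (fun q => (-1) * f q).
  by apply/funext => q; rewrite mulN1r.
rewrite (@dirderM O (fun=> -1)) //; last exact: smooth_on_cst.
by rewrite dirder_cst mul0r add0r mulN1r.
Qed.

Lemma dirder_sum W O n (f : 'I_n -> M -> W) p x : O p ->
  (forall k, smooth_on O (f k)) ->
  dirder p x (fun q => \sum_k f k q) = \sum_k dirder p x (f k).
Proof.
move=> Op hf; apply: (derive_sumE (f := fun k => f k \o chartV p)) => k.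
exact: smooth_on_diff_self (hf k) Op.
Qed.

End DirectionalDerivatives.

(** * Maps between manifolds and the chain rule *)

Section AlongMaps.
Context {R : realType} {d m : nat} {M : manifold R d} {N : manifold R m}.
Context (F : M -> N) (hF : smooth_map F).
Implicit Types (p q : M).

Lemma preimage_open (O : set N) : open O -> open (F @^-1` O).
Proof. by move=> oO; have [cF _] := hF; apply: open_comp => // x _; exact: cF. Qed.

Lemma smooth_map_chart (y : N) p : dom y (F p) ->
  differentiable ((chart y \o F) \o chartV p) (chart p p).
Proof. by move=> dp; have [_ h] := hF; exact: smooth_on_diff_self (h y) dp. Qed.

Lemma dmapE p x : dmap F p x = dirder p x (chart (F p) \o F).
Proof.
rewrite /dmap linfun_val // => a u v; rewrite dirder_linear //.
apply: smooth_map_chart; exact: dom_mem.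
Qed.

(** The chain rule, with [f] read in an arbitrary chart about [F p]; the first equation is the
    passage from [chart (F p)] to that chart. *)
Lemma dirder_dmap (W : normedModType R) (f : N -> W) (y : N) p x : dom y (F p) ->
  differentiable (f \o chartV y) (chart y (F p)) ->
  dirder (F p) (dmap F p x) f =
    'D_(dirder p x (chart y \o F)) (f \o chartV y) (chart y (F p)) /\
  dirder p x (f \o F) = dirder (F p) (dmap F p x) f.
Proof.
move=> dy df.
have dT : differentiable (chart y \o chartV (F p)) (chart (F p) (F p)).
  by apply: chart_diff => //; exact: dom_mem.
(* Applied twice: to [f] itself, and to [chart y] as a function read in [chart (F p)]. *)
have key (z : N) (W' : normedModType R) (h : N -> W') : dom z (F p) ->
    differentiable (h \o chartV z) (chart z (F p)) ->
    dirder p x (h \o F) =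
    'D_(dirder p x (chart z \o F)) (h \o chartV z) (chart z (F p)).
  move=> dz dh.
  have e : dirder p x (h \o F) =
      'D_x ((h \o chartV z) \o ((chart z \o F) \o chartV p)) (chart p p).
    apply: near_eq_derive.
    have dz' : (F @^-1` dom z) p by [].
    apply: filterS (near_chart (preimage_open (dom_open z)) dz' (dom_mem p)).
    by move=> u /cimgP[_ /= hu _] /=; rewrite chartK.
  rewrite e (@derive_comp _ _ _ _ ((chart z \o F) \o chartV p) (h \o chartV z)).
  - by rewrite /= (chartK (dom_mem p)).
  - exact: smooth_map_chart.
  - by rewrite /= (chartK (dom_mem p)).
have e1 : dirder (F p) (dmap F p x) f =
    'D_(dirder p x (chart y \o F)) (f \o chartV y) (chart y (F p)).
  have -> := dirder_chart (dmap F p x) dy df; rewrite dmapE.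
  have e2 := key (F p) _ (chart y) (dom_mem _) dT.
  by congr ('D_ _ _ _); exact: esym e2.
split; first exact: e1.
exact: etrans (key y _ f dy df) (esym e1).
Qed.

End AlongMaps.

Lemma dmap_id (R : realType) m (N : manifold R m) (p : N) x :
  dmap (N := N) idfun p x = x.
Proof.
rewrite /dmap linfun_val; first exact: dirder_chart_self.
move=> a u v; rewrite dirder_linear //.
by apply: chart_diff; exact: dom_mem.
Qed.

(** * Covariant derivatives of endomorphism fields *)

Section TensorDerivative.
Context {R : realType} {m : nat} {N : manifold R m}.
Context (Gam : N -> 'Hom('rV[R]_m, 'End('rV[R]_m))).
Implicit Types (p q : N) (x y : 'rV[R]_m) (O : set N) (A : N -> 'End('rV[R]_m)).

Lemma nablaE p x (X : N -> 'rV[R]_m) :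
  nabla Gam x X p =
  dirder p x (fun q => dirder q (X q) (chart p)) + Gam p x (X p).
Proof. by rewrite /nabla /cov dmap_id. Qed.

Lemma nabla_cfield p x y : nabla Gam x (cfield p y) p = Gam p x y.
Proof.
rewrite nablaE cfield_self.
rewrite (dirder_ext x (dom_open p) (dom_mem p) (h := fun=> y)).
  by rewrite dirder_cst add0r.
by move=> q dq; exact: chart_cfield.
Qed.

(** The tensor [(nabla_x A) y]: the vector [y] is extended by the coordinate field of [chart p],
    whose covariant derivative is [Gam p x y]. *)
Definition tensor_deriv A p x y : 'rV[R]_m :=
  nabla Gam x (fun q => A q (cfield p y q)) p - A p (Gam p x y).

(** Smoothness of an endomorphism field, tested on smooth fields because its matrices in the
    pointwise charts need not be continuous. *)
Definition preserves_smooth O A : Prop := forall (O' : set N) X, open O' ->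
  O' `<=` O -> smooth_field O' X -> smooth_field O' (fun q => A q (X q)).

(** The rows of the matrix of [A] in the fixed [chart p]. *)
Let frame A p k q : 'rV[R]_m := dirder q (A q (cfield p (delta_mx 0 k) q)) (chart p).

Lemma frame_smooth O A p k : open O -> preserves_smooth O A ->
  smooth_on (O `&` dom p) (frame A p k).
Proof.
move=> oO hA; have o : open (O `&` dom p) by apply: openI => //; exact: dom_open.
have s1 : O `&` dom p `<=` dom p by move=> q [].
apply: smooth_field_coord s1; apply: hA; [exact: o|exact: subIsetl|].
exact: smooth_cfield.
Qed.

Lemma chart_tensor A p q x : dom p q ->
  dirder q (A q x) (chart p) = \sum_k dirder q x (chart p) 0 k *: frame A p k q.
Proof.
move=> dq; have df : differentiable (chart p \o chartV q) (chart q q).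
  by apply: chart_diff => //; exact: dom_mem.
rewrite -{1}(cfield_chart x dq) cfield_sum // linear_sum.
rewrite [LHS]deriveE // linear_sum; apply: eq_bigr => k _.
by rewrite linearZ linearZ -deriveE.
Qed.

Lemma tensor_derivE O A p x y : open O -> O p -> preserves_smooth O A ->
  tensor_deriv A p x y = \sum_k y 0 k *: dirder p x (frame A p k) +
    Gam p x (A p y) - A p (Gam p x y).
Proof.
move=> oO Op hA; rewrite /tensor_deriv nablaE cfield_self; congr (_ + _ - _).
have o : open (O `&` dom p) by apply: openI => //; exact: dom_open.
have Op' : (O `&` dom p) p by split=> //; exact: dom_mem.
have e1 : dirder p x (fun q => dirder q (A q (cfield p y q)) (chart p)) =
    dirder p x (fun q => \sum_k y 0 k *: frame A p k q).
  apply: (dirder_ext x o Op') => q [Oq dq].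
  by rewrite [LHS]chart_tensor // chart_cfield.
apply: (etrans e1).
have e2 : dirder p x (fun q => \sum_k y 0 k *: frame A p k q) =
    \sum_k dirder p x (fun q => y 0 k *: frame A p k q).
  apply: (dirder_sum (O := O `&` dom p)) => // k.
  by apply: smooth_onZ => //; [exact: smooth_on_cst|exact: frame_smooth].
apply: (etrans e2); apply: eq_bigr => k _.
have df := smooth_on_diff_self (frame_smooth p k oO hA) Op'.
have dc : differentiable ((fun=> y 0 k) : 'rV[R]_m -> R^o) (chart p p).
  exact: differentiable_cst.
have [_ e] := derive_scale x dc df.
by rewrite [LHS]e derive_cst scale0r add0r.
Qed.

Section Along.
Context {d : nat} {M : manifold R d} (F : M -> N) (hF : smooth_map F).

(** The Leibniz rule: near [p] the reading of [A Z] is the sum of the components of [Z] times the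
    functions [frame A (F p) k] composed with [F]. The product and chain rules give [A] of the
    derivative of [Z] plus derivatives of [frame], which [tensor_derivE] recognises. *)
Lemma cov_tensor O A (Z : M -> 'rV[R]_m) (p : M) (x : 'rV[R]_d) :
  open O -> O (F p) -> preserves_smooth O A ->
  differentiable ((fun q : M => dirder (F q) (Z q) (chart (F p))) \o chartV p) (chart p p) ->
  cov Gam F (fun q : M => A (F q) (Z q)) p x =
  A (F p) (cov Gam F Z p x) + tensor_deriv A (F p) (dmap F p x) (Z p).
Proof.
move=> oO Op hA dZ.
have o : open (O `&` dom (F p)) by apply: openI => //; exact: dom_open.
have Op' : (O `&` dom (F p)) (F p) by split=> //; exact: dom_mem.
pose hZ (q : M) := dirder (F q) (Z q) (chart (F p)).
have e1 : dirder p x (fun q : M => dirder (F q) (A (F q) (Z q)) (chart (F p))) =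
    dirder p x (fun q : M => \sum_k hZ q 0 k *: frame A (F p) k (F q)).
  apply: (dirder_ext x (preimage_open hF o) Op') => q [Oq dq].
  exact: chart_tensor.
have dE k : differentiable (frame A (F p) k \o chartV (F p)) (chart (F p) (F p)).
  exact: smooth_on_diff_self (frame_smooth (F p) k oO hA) Op'.
have dEF k : differentiable ((frame A (F p) k \o F) \o chartV p) (chart p p).
  have dT := smooth_map_chart hF (dom_mem (F p)).
  have dT' : differentiable ((frame A (F p) k \o chartV (F p)) \o
      ((chart (F p) \o F) \o chartV p)) (chart p p).
    by apply: differentiable_comp => //=; rewrite (chartK (dom_mem p)).
  apply: near_eq_differentiable dT'.
  have dp' : (F @^-1` dom (F p)) p by exact: dom_mem.
  apply: filterS (near_chart (preimage_open hF (dom_open (F p))) dp' (dom_mem p)).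
  by move=> u /cimgP[_ /= hu _] /=; rewrite chartK.
have dc k : differentiable (fun u => hZ (chartV p u) 0 k : R^o) (chart p p).
  exact: ((differentiable_rV (hZ \o chartV p) (chart p p)).2 dZ k).
have e2 : dirder p x (fun q : M => \sum_k hZ q 0 k *: frame A (F p) k (F q)) =
    \sum_k (dirder p x hZ 0 k *: frame A (F p) k (F p) +
            hZ p 0 k *: dirder (F p) (dmap F p x) (frame A (F p) k)).
  rewrite /dirder.
  rewrite (derive_sumE (f := fun k u => hZ (chartV p u) 0 k *: frame A (F p) k (F (chartV p u)))).
    apply: eq_bigr => k _.
    have [_ e] := derive_scale x (dc k) (dEF k).
    have c1 : 'D_x (fun u => hZ (chartV p u) 0 k : R^o) (chart p p) =
        dirder p x hZ 0 k by exact: esym (derive_coord x k dZ).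
    have c2 := f_equal (frame A (F p) k \o F) (chartK (dom_mem p)).
    have c3 := f_equal (fun q : M => hZ q 0 k) (chartK (dom_mem p)).
    have c4 := (dirder_dmap hF x (dom_mem (F p)) (dE k)).2.
    apply: (etrans e).
    exact: (f_equal2 +%R (f_equal2 *:%R c1 c2) (f_equal2 *:%R c3 c4)).
  by move=> k; have [] := derive_scale x (dc k) (dEF k).
rewrite /cov e1 e2 (tensor_derivE _ _ oO Op hA).
have hZp : hZ p = Z p by exact: dirder_chart_self.
rewrite big_split /= hZp linearD /=.
have -> : \sum_k dirder p x hZ 0 k *: frame A (F p) k (F p) = A (F p) (dirder p x hZ).
  rewrite {2}[dirder p x hZ]row_sum_delta linear_sum; apply: eq_bigr => k _.
  by rewrite linearZ /frame cfield_self dirder_chart_self.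
rewrite -/hZ -!addrA; congr (_ + _).
set a := \sum_k _; set b := Gam _ _ _; set c := A _ _.
by rewrite [RHS]addrCA; congr (_ + _); rewrite addrCA subrr addr0.
Qed.

End Along.

Lemma smooth_map_id : smooth_map (N := N) (idfun : N -> N).
Proof.
split=> [x|y p k]; first exact: cvg_id.
exact: transition_smooth.
Qed.

Lemma smooth_field_diff O X p : O p -> smooth_field O X ->
  differentiable ((fun q => dirder q (X q) (chart p)) \o chartV p) (chart p p).
Proof.
by move=> Op hX; apply: smooth_on_diff_self (hX p) _; split=> //; exact: dom_mem.
Qed.

Lemma nabla_tensor O A X p x : open O -> O p -> preserves_smooth O A ->
  smooth_field O X ->
  nabla Gam x (fun q => A q (X q)) p =
  A p (nabla Gam x X p) + tensor_deriv A p x (X p).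
Proof.
move=> oO Op hA hX; rewrite -{3}(dmap_id p x).
by apply: (cov_tensor smooth_map_id) hA _; [exact: oO|exact: Op|exact: smooth_field_diff hX].
Qed.

End TensorDerivative.

(** * Push-forward of vector fields and torsion along a map *)

Section PushForward.
Context {R : realType} {d m : nat} {M : manifold R d} {N : manifold R m}.
Context (F : M -> N) (hF : smooth_map F).
Implicit Types (p q : M) (X Y : M -> 'rV[R]_d) (O : set M).

Lemma pushforward_chart p q x : dom p q -> dom (F p) (F q) ->
  dirder (F q) (dmap F q x) (chart (F p)) =
  'D_(dirder q x (chart p)) ((chart (F p) \o F) \o chartV p) (chart p q).
Proof.
move=> dq dFq.
have df := chart_diff dFq dFq.
have e := (dirder_dmap hF x dFq df).2.
apply: (etrans (esym e)); apply: dirder_chart; first exact: dq.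
by have [_ h] := hF; exact: smooth_on_diff (h (F p)) dFq dq.
Qed.

(** In charts the push-forward is the derivative of [Phi] along the components of [X]. The product
    rule yields the push-forward of the derivative of these components and the Hessian of [Phi] at
    [y] and [X p], kept explicit for a later cancellation. *)
Lemma pushforward_derive O X p y : open O -> O p -> smooth_field O X ->
  let hFX := fun q => dirder (F q) (dmap F q (X q)) (chart (F p)) in
  let Phi := (chart (F p) \o F) \o chartV p in
  differentiable (hFX \o chartV p) (chart p p) /\
  dirder p y hFX =
    dmap F p (dirder p y (fun q => dirder q (X q) (chart p))) +
    'D_(X p) ('D_y Phi) (chart p p).
Proof.
move=> oO Op hX hFX Phi.
pose hX' q := dirder q (X q) (chart p).
pose O' := O `&` dom p `&` F @^-1` dom (F p).
have oO' : open O'.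
  apply: openI; first by apply: openI => //; exact: dom_open.
  by apply: (preimage_open hF); exact: dom_open.
have O'p : O' p by split; [split=> //; exact: dom_mem|exact: dom_mem].
have sPhi : Ck 2 (cimg p (F @^-1` dom (F p))) Phi by have [_ h] := hF; exact: h.
have oFp : open (cimg p (F @^-1` dom (F p))).
  by apply: cimg_open; apply: (preimage_open hF); exact: dom_open.
have Fpp : cimg p (F @^-1` dom (F p)) (chart p p).
  by apply: cimg_mem; exact: dom_mem.
have [dPhi cPhi] := sPhi.
have e1 : \forall u \near chart p p, (\sum_k hX' (chartV p u) 0 k *:
    'D_(delta_mx 0 k) Phi u) = (hFX \o chartV p) u.
  apply: filterS (near_chart oO' O'p (dom_mem p)) => u /cimgP[_ [[Ou du] Fu] eu].
  have h1 := pushforward_chart (X (chartV p u)) du Fu.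
  have du' : differentiable Phi u.
    by apply: dPhi; rewrite -eu; apply: cimg_mem.
  by apply: esym; rewrite /= /hFX h1 eu; exact: derive_sumr.
have dh : differentiable (hX' \o chartV p) (chart p p).
  exact: smooth_field_diff Op hX.
have dc k : differentiable (fun u => hX' (chartV p u) 0 k : R^o) (chart p p).
  exact: ((differentiable_rV (hX' \o chartV p) (chart p p)).2 dh k).
have dD k : differentiable ('D_(delta_mx 0 k) Phi) (chart p p).
  by have [h _] := cPhi (delta_mx 0 k); exact: h.
have ds k := derive_scale y (dc k) (dD k).
split.
  apply: near_eq_differentiable e1 _.
  by apply: differentiable_sumE => k; have [] := ds k.
apply: (etrans (esym (near_eq_derive y e1))).
rewrite (derive_sumE (f := fun k u => hX' (chartV p u) 0 k *: 'D_(delta_mx 0 k) Phi u)); last first.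
  by move=> k; have [] := ds k.
rewrite dmapE // {1}/dirder.
have dPp : differentiable Phi (chart p p) by exact: dPhi.
have -> := derive_sumr (dirder p y hX') dPp.
have dDy : differentiable ('D_y Phi) (chart p p).
  by have [h _] := cPhi y; exact: h.
have -> := derive_sumr (X p) dDy.
rewrite -big_split; apply: eq_bigr => k _ /=.
have [_ e] := ds k; apply: (etrans e).
have c1 : 'D_y (fun u => hX' (chartV p u) 0 k : R^o) (chart p p) =
    dirder p y hX' 0 k by exact: esym (derive_coord y k dh).
have c2 : hX' (chartV p (chart p p)) 0 k = X p 0 k.
  by rewrite (chartK (dom_mem p)) /hX' dirder_chart_self.
(* The order of differentiation is exchanged so that the basis directions, weighted by the
   components of [X p], are outermost and sum up to [X p]. *)
have c3 := derive_swap_rV (delta_mx 0 k) y oFp Fpp sPhi.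
exact: (f_equal2 +%R (f_equal2 *:%R c1 erefl) (f_equal2 *:%R c2 c3)).
Qed.

(** Antisymmetrisation cancels the Hessians of the map and the terms in the symmetric [Gam]; what is
    left is the coordinate formula of the bracket. *)
Lemma cov_torsion (Gam : N -> 'Hom('rV[R]_m, 'End('rV[R]_m))) O X Y p :
  open O -> O p -> smooth_field O X -> smooth_field O Y ->
  (forall v w, Gam (F p) v w = Gam (F p) w v) ->
  cov Gam F (fun q => dmap F q (X q)) p (Y p) -
  cov Gam F (fun q => dmap F q (Y q)) p (X p) = - dmap F p (bracket X Y p).
Proof.
move=> oO Op hX hY sG; rewrite /cov.
have [_ ->] := pushforward_derive (Y p) oO Op hX.
have [_ ->] := pushforward_derive (X p) oO Op hY.
have sPhi : Ck 2 (cimg p (F @^-1` dom (F p))) ((chart (F p) \o F) \o chartV p).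
  by have [_ h] := hF; exact: h.
have oFp : open (cimg p (F @^-1` dom (F p))).
  by apply: cimg_open; apply: (preimage_open hF); exact: dom_open.
have Fpp : cimg p (F @^-1` dom (F p)) (chart p p).
  by apply: cimg_mem; exact: dom_mem.
have -> := derive_swap_rV (X p) (Y p) oFp Fpp sPhi.
rewrite (sG (dmap F p (Y p))) /bracket linearB /=.
have alg (a b c e : 'rV[R]_m) : a + b + c - (e + b + c) = - (e - a).
  by rewrite -[a + b + c]addrA -[e + b + c]addrA (addrC e (b + c)) addrKA opprB.
exact: alg.
Qed.

End PushForward.

(** * The exterior derivative in a fixed chart *)

Section ExteriorDerivative.
Context {R : realType} {m : nat} {N : manifold R m}.
Implicit Types (p q : N) (O : set N).

(* [cfield p y] and [cfield q (cfield p y q)] agree at [q] but not nearby; the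
   difference is a second derivative of the transition map, which cancels upon
   antisymmetrisation. *)
Lemma extd_chart (w : N -> 'Hom('rV[R]_m, R^o)) O p q y z :
  open O -> O q -> dom p q ->
  (forall v, smooth_on (O `&` dom p) (fun q => w q (cfield p v q))) ->
  extd (fun q v => w q v : R) q (cfield p y q) (cfield p z q) =
  2^-1 * ('D_y ((fun q => w q (cfield p z q)) \o chartV p) (chart p q) -
          'D_z ((fun q => w q (cfield p y q)) \o chartV p) (chart p q)).
Proof.
move=> oO Oq dq hw.
pose O' := O `&` dom p `&` dom q.
have op : open (O `&` dom p) by apply: openI => //; exact: dom_open.
have oO' : open O' by apply: openI => //; exact: dom_open.
have O'q : O' q by split; [split|exact: dom_mem].
have qq := dom_mem q.
pose T := chart p \o chartV q.
have oT : open (cimg q (dom p)) by apply: cimg_open; exact: dom_open.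
have qT : cimg q (dom p) (chart q q) by exact: cimg_mem.
have sT : Ck 2 (cimg q (dom p)) T by exact: transition_smooth_cimg.
have [dT cT] := sT.
pose W k q' : R^o := w q' (cfield p (delta_mx 0 k) q').
have dW k : differentiable (W k \o chartV q) (chart q q).
  exact: smooth_on_diff (hw _) (conj Oq dq) qq.
have dWp k : differentiable (W k \o chartV p) (chart p q).
  exact: smooth_on_diff (hw _) (conj Oq dq) dq.
(* The first sum, a second derivative of the transition map [T], is the part symmetric in [a] and
   [b]. *)
have key a b : dirder q (cfield p a q) (fun q' => w q' (cfield q (cfield p b q) q') : R^o) =
    \sum_k 'D_(cfield p a q) ('D_(cfield p b q) T) (chart q q) 0 k * W k q +
    'D_a ((fun q => w q (cfield p b q) : R^o) \o chartV p) (chart p q).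
  pose zeta (u : 'rV[R]_m) := 'D_(cfield p b q) T u.
  have dz : differentiable zeta (chart q q) by have [h _] := cT (cfield p b q); exact: h.
  have dzk k : differentiable (fun u => zeta u 0 k : R^o) (chart q q).
    exact: (differentiable_rV _ _).2 dz k.
  have e1 : \forall u \near chart q q,
      ((fun q' => w q' (cfield q (cfield p b q) q') : R^o) \o chartV q) u =
      \sum_k zeta u 0 k * (W k \o chartV q) u.
    apply: filterS (near_chart oO' O'q qq) => u /cimgP[/= du [[Ou dpu] _] eu].
    have df := chart_diff dpu (dom_mem (chartV q u)).
    have h1 := dirder_cfield (cfield p b q) du df.
    rewrite eu in h1.
    rewrite -[in LHS](cfield_chart (cfield q _ _) dpu) h1 cfield_sum // linear_sum.
    by apply: eq_bigr => k _; rewrite linearZ.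
  apply: (etrans (near_eq_derive (cfield p a q) e1)).
  rewrite (derive_sumE (f := fun k u => zeta u 0 k * (W k \o chartV q) u : R^o)); last first.
    by move=> k; apply: differentiableM; [exact: dzk|exact: dW].
  have zq : zeta (chart q q) = b by exact: chart_cfield.
  have e2 : 'D_a ((fun q => w q (cfield p b q) : R^o) \o chartV p) (chart p q) =
      \sum_k b 0 k * 'D_a (W k \o chartV p) (chart p q).
    have e3 : \forall u \near chart p q,
        ((fun q => w q (cfield p b q) : R^o) \o chartV p) u =
        \sum_k b 0 k * (W k \o chartV p) u.
      apply: filterS (near_chart op (conj Oq dq) dq) => u /cimgP[/= du _ _].
      by rewrite cfield_sum // linear_sum; apply: eq_bigr => k _; rewrite linearZ.
    apply: (etrans (near_eq_derive a e3)).
    rewrite (derive_sumE (f := fun k u => b 0 k * (W k \o chartV p) u : R^o)); last first.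
      by move=> k; apply: differentiableM; [exact: differentiable_cst|exact: dWp].
    apply: eq_bigr => k _.
    have e4 := @deriveME _ _ (fun=> b 0 k) _ _ a (differentiable_cst (b 0 k : R^o) _) (dWp k).
    by apply: (etrans e4); rewrite derive_cst mul0r add0r.
  rewrite e2 -big_split; apply: eq_bigr => k _ /=.
  have e5 := deriveME (cfield p a q) (dzk k) (dW k).
  apply: (etrans e5).
  have c1 := esym (derive_coord (cfield p a q) k dz).
  have c2 := f_equal (W k) (chartK qq).
  have c3 := f_equal (fun v : 'rV[R]_m => v 0 k) zq.
  have c4 : 'D_(cfield p a q) (W k \o chartV q) (chart q q) = 'D_a (W k \o chartV p) (chart p q).
    exact: (dirder_cfield a dq (dW k)).
  exact: (f_equal2 +%R (f_equal2 *%R c1 c2) (f_equal2 *%R c3 c4)).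
have sw := derive_swap_rV (cfield p y q) (cfield p z q) oT qT sT.
have sw' := f_equal (fun v : 'rV[R]_m => \sum_k v 0 k * W k q) sw.
have alg (a b c e : R) : a = b -> a + c - (b + e) = c - e.
  by move=> ->; rewrite (addrC b c) addrKA.
apply: (f_equal ( *%R 2^-1)).
apply: (etrans (f_equal2 (fun s t => s - t) (key y z) (key z y))).
exact: alg (esym sw').
Qed.

End ExteriorDerivative.

(** * The Levi-Civita connection *)

Section LeviCivita.
Context {R : realType} {m : nat} {N : manifold R m} {g : N -> 'M[R]_m}.
Context {Gam : N -> 'Hom('rV[R]_m, 'End('rV[R]_m))} (hLC : levi_civita g Gam).
Implicit Types (p q : N) (O : set N).

(** Torsion-freeness for coordinate fields, whose bracket vanishes and whose covariant derivatives
    are the values of [Gam]. *)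
Lemma Gam_sym p v w : Gam p v w = Gam p w v.
Proof.
have sc u := smooth_cfield u (dom_open p) (@subset_refl _ (dom p)).
have [h _] := hLC (dom_open p) (dom_mem p) (sc v) (sc w) (sc w).
move: h; rewrite !cfield_self !nabla_cfield /bracket.
have e u z : dirder p u (fun q => dirder q (cfield p z q) (chart p)) = 0.
  rewrite -[RHS](dirder_cst p u z); apply: dirder_ext (dom_open p) (dom_mem p) _.
  by move=> q dq; exact: chart_cfield.
by rewrite !e subrr => /subr0_eq.
Qed.

(** The direction [x] is a single vector; extending it by a coordinate field makes metric
    compatibility applicable. *)
Lemma metric_deriv O p x Y Z : open O -> O p -> smooth_field O Y ->
  smooth_field O Z ->
  dirder p x (fun q => ip (g q) (Y q) (Z q) : R^o) =
  ip (g p) (nabla Gam x Y p) (Z p) + ip (g p) (Y p) (nabla Gam x Z p).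
Proof.
move=> oO Op hY hZ.
have o : open (O `&` dom p) by apply: openI => //; exact: dom_open.
have Op' : (O `&` dom p) p by split=> //; exact: dom_mem.
have sX := smooth_cfield x o (@subIsetr _ O (dom p)).
have sY := smooth_field_sub (@subIsetl _ O (dom p)) hY.
have sZ := smooth_field_sub (@subIsetl _ O (dom p)) hZ.
have [_ h] := hLC o Op' sX sY sZ.
by move: h; rewrite cfield_self.
Qed.

Lemma nabla_torsion O p X Y : open O -> O p -> smooth_field O X ->
  smooth_field O Y ->
  bracket X Y p = nabla Gam (X p) Y p - nabla Gam (Y p) X p.
Proof. by move=> oO Op hX hY; have [h _] := hLC oO Op hX hY hY. Qed.

End LeviCivita.

Section SmoothDifferences.
Context {R : realType} {d : nat} {M : manifold R d} (O : set M) (oO : open O).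
Context (f h : M -> R^o) (sf : smooth_on O f) (sh : smooth_on O h).

Lemma smooth_onN : smooth_on O (fun q => - h q : R^o).
Proof.
apply: smooth_on_ext (smooth_onM oO (smooth_on_cst O (-1 : R^o)) sh) => //.
by move=> q _; rewrite mulN1r.
Qed.

Lemma smooth_onB : smooth_on O (fun q => f q - h q : R^o).
Proof. exact: smooth_onD oO sf smooth_onN. Qed.

Lemma dirderB p x : O p ->
  dirder p x (fun q => f q - h q : R^o) = dirder p x f - dirder p x h.
Proof.
by move=> Op; rewrite (dirderD x Op sf smooth_onN) (dirderN x Op sh).
Qed.

End SmoothDifferences.

Lemma ip_sumr (R : realType) m (B : 'M[R]_m) n (c : 'I_n -> R) (v : 'I_n -> 'rV[R]_m) y :
  ip B y (\sum_k c k *: v k) = \sum_k c k * ip B y (v k).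
Proof.
rewrite (big_morph (ip B y) (ipDr B y) (ip0r B y)).
by apply: eq_bigr => k _; rewrite ipZr.
Qed.

(** * Iterated coordinate derivatives *)

Section CoordinateDerivative.
Context {R : realType} {m : nat} {N : manifold R m}.
Implicit Types (p q : N) (O : set N).

(** Unlike in [dirder q], the chart stays fixed while [q] moves, so that a smooth [f] gives again a
    smooth function, which can be differentiated once more. *)
Definition pderiv p (y : 'rV[R]_m) (f : N -> R^o) q : R^o :=
  'D_y (f \o chartV p) (chart p q).

Lemma smooth_pderiv p O y f : open O -> O `<=` dom p -> smooth_on O f ->
  smooth_on O (pderiv p y f).
Proof.
move=> oO Od hf; apply: (smooth_on_chart (p := p)) => // k.
have [_ h] := hf p k.+1.
apply: Ck_ext (h y); first exact: cimg_open.
by move=> x /cimgP[_ _ /= e]; rewrite /pderiv /= e.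
Qed.

Lemma dirder_pderiv p O y x f : open O -> O p -> smooth_on O f ->
  dirder p x (pderiv p y f) = 'D_x ('D_y (f \o chartV p)) (chart p p).
Proof.
move=> oO Op hf; apply: near_eq_derive.
apply: filterS (near_chart oO Op (dom_mem p)) => u /cimgP[_ _ e].
by rewrite /pderiv /= e.
Qed.

Lemma dirder_pderivC p O y x f : open O -> O p -> smooth_on O f ->
  dirder p x (pderiv p y f) = dirder p y (pderiv p x f).
Proof.
move=> oO Op hf; rewrite (dirder_pderiv _ _ oO Op hf) (dirder_pderiv _ _ oO Op hf).
have := derive_swap y x (cimg_open (p := p) oO) (cimg_mem (dom_mem p) Op) (hf p 2).
exact.
Qed.

End CoordinateDerivative.

(** * Contact structures *)

(* The variables stand for the terms of the expanded identity in
   [tensor_deriv_cyclic]. *)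
Lemma cyclic_algebra (R : realType) (G1 G2 G3 M1 M2 M3 D1 D2 D3 P1 P2 P3 Q1 Q2 Q3 : R)
    (e1 e2 e3 f1 f2 f3 k1 k2 k3 s1 s2 s3 eps : R) :
  G1 = M2 -> G2 = M3 -> G3 = M1 -> P1 = Q1 -> P2 = Q2 -> P3 = Q3 ->
  e1 = f1 + 2 * k1 -> e2 = f2 + 2 * k2 -> e3 = f3 + 2 * k3 ->
  G1 + (- M1 + D1) = 2^-1 * (P1 - Q3) - eps * 2^-1 * (s2 * f2 - s3 * e3) ->
  G2 + (- M2 + D2) = 2^-1 * (P2 - Q1) - eps * 2^-1 * (s3 * f3 - s1 * e1) ->
  G3 + (- M3 + D3) = 2^-1 * (P3 - Q2) - eps * 2^-1 * (s1 * f1 - s2 * e2) ->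
  D1 + D2 + D3 = eps * (s1 * k1 + s2 * k2 + s3 * k3).
Proof. by move=> -> -> -> -> -> -> -> -> -> h1 h2 h3; lra. Qed.

(** * The derivative of a contact tensor on the horizontal bundle *)

Section ContactTensor.
Context {R : realType} {n : nat} {N : manifold R (rdim n)}.
Local Notation m := (rdim n).
Context {g : N -> 'M[R]_m}.
Context {Gam : N -> 'Hom('rV[R]_m, 'End('rV[R]_m))} (hLC : levi_civita g Gam).
Context (gC : forall p, (g p)^T = g p).
Context (gS : forall (O : set N) X Y, open O -> smooth_field O X ->
  smooth_field O Y -> smooth_on O (fun p => ip (g p) (X p) (Y p) : R^o)).

(* The structure equations of [(A, K, w, w')] are those of [(G, H, u, v)] for
   [eps = 1] and of [(H, G, v, u)] for [eps = -1]. *)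
Context (O : set N) (oO : open O).
Context (A K : N -> 'End('rV[R]_m)) (w w' : N -> 'Hom('rV[R]_m, R^o)).
Context (W W' : N -> 'rV[R]_m) (eps : R) (s : N -> 'rV[R]_m -> R).
Context (sA : preserves_smooth O A) (sW : smooth_field O W) (sW' : smooth_field O W').
Context (AW : forall q, O q -> A q (W q) = 0 /\ A q (W' q) = 0).
Context (wE : forall q x, O q -> w q x = ip (g q) (W q) x).
Context (wE' : forall q x, O q -> w' q x = ip (g q) (W' q) x).
Context (WW : forall q, O q -> [/\ ip (g q) (W q) (W q) = 1,
  ip (g q) (W' q) (W' q) = 1 & ip (g q) (W q) (W' q) = 0]).
Context (skewA : forall q x y, O q -> ip (g q) (A q x) y = - ip (g q) x (A q y)).
Context (sqA : forall q x, O q -> A q (A q x) = - x + w q x *: W q + w' q x *: W' q).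
Context (dw : forall q x y, O q -> extd (fun q z => w q z : R) q x y =
  ip (g q) x (A q y) + eps * wedge (s q) (fun z => w' q z : R) x y).
Context (dw' : forall q x y, O q -> extd (fun q z => w' q z : R) q x y =
  ip (g q) x (K q y) - eps * wedge (s q) (fun z => w q z : R) x y).

Context (p : N) (Op : O p).
Local Notation ipp := (ip (g p)).
Local Notation DA := (tensor_deriv Gam A p).
Local Notation E := (cfield p).
Let O1 := O `&` dom p.

Let oO1 : open O1. Proof. by apply: openI => //; exact: dom_open. Qed.
Let O1p : O1 p. Proof. by split=> //; exact: dom_mem. Qed.
Let O1O : O1 `<=` O. Proof. exact: subIsetl. Qed.
Let O1d : O1 `<=` dom p. Proof. exact: subIsetr. Qed.
Let sE y : smooth_field O1 (E y). Proof. exact: smooth_cfield. Qed.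
Let sAE y : smooth_field O1 (fun q => A q (E y q)).
Proof. exact: sA oO1 O1O (sE y). Qed.
Let sW1 : smooth_field O1 W. Proof. exact: smooth_field_sub O1O sW. Qed.
Let sW1' : smooth_field O1 W'. Proof. exact: smooth_field_sub O1O sW'. Qed.

Definition horiz q x := ip (g q) (W q) x = 0 /\ ip (g q) (W' q) x = 0.

Lemma nabla_AE x y : nabla Gam x (fun q => A q (E y q)) p = A p (Gam p x y) + DA x y.
Proof.
rewrite (nabla_tensor Gam x oO1 O1p _ (sE y)); last first.
  by move=> O' X oO' sO'; apply: sA => // q /sO' /O1O.
by rewrite nabla_cfield cfield_self.
Qed.

(** Derivative of [g (A y, z) = - g (y, A z)]: the metric is parallel, and the terms in [Gam] cancel
    by the skewness of [A] itself. *)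
Lemma tensor_deriv_skew x y z : ipp (DA x y) z = - ipp y (DA x z).
Proof.
have h1 := metric_deriv hLC x oO1 O1p (sAE y) (sE z).
have h2 := metric_deriv hLC x oO1 O1p (sE y) (sAE z).
have e : dirder p x (fun q => ip (g q) (A q (E y q)) (E z q) : R^o) =
    - dirder p x (fun q => ip (g q) (E y q) (A q (E z q)) : R^o).
  rewrite -(dirderN x O1p (gS oO1 (sE y) (sAE z))).
  by apply: dirder_ext oO1 O1p _ => q /O1O Oq; exact: skewA.
move: e; rewrite h1 h2 !nabla_AE !nabla_cfield !cfield_self.
rewrite ipDl ipDr !skewA //; lra.
Qed.

Lemma horizA y : horiz p (A p y).
Proof.
have [a b] := AW Op.
by split; rewrite ipC // skewA // ?a ?b ip0r oppr0.
Qed.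

Lemma horiz_sqA y : horiz p y -> A p (A p y) = - y.
Proof. by move=> [h1 h2]; rewrite sqA // wE // wE' // h1 h2 !scale0r !addr0. Qed.

Let uh y q : R^o := w q (E y q).
Let uh' y q : R^o := w' q (E y q).
(** The form [dw] on the coordinate fields of the fixed chart, in a shape whose smoothness does not
    rest on [s]. *)
Let du y z q : R^o := 2^-1 * (pderiv p y (uh z) q - pderiv p z (uh y) q).
(* [s] is not known to be smooth, but [tau y = dw (y, W')] is; it differs from
   [eps / 2 * s y] by a multiple of [w' y], which cancels in [tau /\ w']. *)
Let hW' q := dirder q (W' q) (chart p).
Let tau y q : R^o := \sum_k hW' q 0 k * du y (delta_mx 0 k) q.
Let omega y z q : R^o := ip (g q) (E y q) (A q (E z q)).

Let suh y : smooth_on O1 (uh y).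
Proof.
apply: (smooth_on_ext oO1 _ (gS oO1 sW1 (sE y))) => q /O1O Oq.
exact: esym (wE _ Oq).
Qed.

Let suh' y : smooth_on O1 (uh' y).
Proof.
apply: (smooth_on_ext oO1 _ (gS oO1 sW1' (sE y))) => q /O1O Oq.
exact: esym (wE' _ Oq).
Qed.

Let sdiff y z : smooth_on O1 (fun q => pderiv p y (uh z) q - pderiv p z (uh y) q : R^o).
Proof.
exact: (smooth_onB oO1 (smooth_pderiv y oO1 O1d (suh z)) (smooth_pderiv z oO1 O1d (suh y))).
Qed.

Let sdu y z : smooth_on O1 (du y z).
Proof. exact: (smooth_onM oO1 (smooth_on_cst O1 (2^-1 : R^o)) (sdiff y z)). Qed.

Let stau y : smooth_on O1 (tau y).
Proof.
apply: (smooth_on_sum oO1) => k; apply: (smooth_onM oO1 _ (sdu _ _)).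
exact: (smooth_on_coord _ oO1).1 (smooth_field_coord sW1' O1d) k.
Qed.

Let duE y z q : O1 q -> du y z q = omega y z q +
  eps * (2^-1 * (s q (E y q) * uh' z q - s q (E z q) * uh' y q)).
Proof.
move=> O1q; have [Oq dq] := O1q.
rewrite -[RHS](dw (E y q) (E z q) Oq); apply: esym.
exact: (extd_chart y z oO Oq dq suh).
Qed.

(** Contraction of [duE] with [W']: the form [omega] drops out because [A W' = 0], and [w' W' = 1]
    isolates [s]. *)
Let tauE y q : O1 q -> tau y q = eps * 2^-1 *
  (s q (E y q) - (\sum_k hW' q 0 k * s q (E (delta_mx 0 k) q)) * uh' y q).
Proof.
move=> O1q; have [Oq dq] := O1q.
have eW : W' q = \sum_k hW' q 0 k *: E (delta_mx 0 k) q.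
  by rewrite -(cfield_sum _ dq) /hW' (cfield_chart _ dq).
have e1 : \sum_k hW' q 0 k * omega y (delta_mx 0 k) q = 0.
  have [_ h] := AW Oq; rewrite -[RHS](ip0r (g q) (E y q)) -h [X in A q X]eW linear_sum.
  have -> : \sum_k A q (hW' q 0 k *: E (delta_mx 0 k) q) =
      \sum_k hW' q 0 k *: A q (E (delta_mx 0 k) q).
    by apply: eq_bigr => k _; rewrite linearZ.
  by rewrite ip_sumr.
have e2 : \sum_k hW' q 0 k * uh' (delta_mx 0 k) q = 1.
  have [_ h _] := WW Oq; rewrite -h -(wE' _ Oq) [X in w' q X]eW linear_sum.
  by apply: eq_bigr => k _; rewrite linearZ.
rewrite /tau.
have -> : \sum_k hW' q 0 k * du y (delta_mx 0 k) q =
    \sum_k hW' q 0 k * omega y (delta_mx 0 k) q +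
    eps * 2^-1 * (s q (E y q) * (\sum_k hW' q 0 k * uh' (delta_mx 0 k) q) -
      (\sum_k hW' q 0 k * s q (E (delta_mx 0 k) q)) * uh' y q).
  rewrite mulr_sumr mulr_suml -sumrB mulr_sumr -big_split.
  apply: eq_bigr => k _; rewrite duE //=.
  have alg (a b e h c d c' d' : R) : a * (b + e * (h * (c * d - c' * d'))) =
      a * b + e * h * (c * (a * d) - a * c' * d') by ring.
  exact: alg.
by rewrite e1 e2 add0r mulr1.
Qed.

(** The structure equation solved for [omega] with smooth terms only, hence an identity that can be
    differentiated. *)
Let omegaE y z q : O1 q ->
  omega y z q = du y z q - (tau y q * uh' z q - tau z q * uh' y q).
Proof.
move=> O1q; rewrite duE // !tauE //.
set a := \sum_k _.
have alg (o u v t1 t2 e h : R) : o = o + e * (h * (t1 * u - t2 * v)) -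
    (e * h * (t1 - a * v) * u - e * h * (t2 - a * u) * v) by ring.
exact: alg.
Qed.

(** The derivatives of [tau] carry the factors [w' y] and [w' z], which vanish at [p]; for the same
    reason [tau] reduces there to [eps / 2] times [s]. *)
Let dirder_omega x y z : horiz p y -> horiz p z ->
  dirder p x (omega y z) =
  2^-1 * (dirder p x (pderiv p y (uh z)) - dirder p x (pderiv p z (uh y))) -
  eps * 2^-1 * (s p y * dirder p x (uh' z) - s p z * dirder p x (uh' y)).
Proof.
move=> [_ hy] [_ hz].
have uy : uh' y p = 0 by rewrite /uh' cfield_self wE'.
have uz : uh' z p = 0 by rewrite /uh' cfield_self wE'.
have st u v := smooth_onM oO1 (stau u) (suh' v).
have e1 : dirder p x (omega y z) =
    dirder p x (fun q => du y z q - (tau y q * uh' z q - tau z q * uh' y q) : R^o).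
  by apply: dirder_ext oO1 O1p _ => q; exact: omegaE.
apply: (etrans e1).
rewrite (dirderB oO1 (sdu y z) (smooth_onB oO1 (st y z) (st z y)) x O1p).
rewrite (dirderB oO1 (st y z) (st z y) x O1p).
rewrite (dirderM x O1p (stau y) (suh' z)) (dirderM x O1p (stau z) (suh' y)).
rewrite (dirderM x O1p (smooth_on_cst O1 (2^-1 : R^o)) (sdiff y z)) dirder_cst.
rewrite (dirderB oO1 (smooth_pderiv y oO1 O1d (suh z)) (smooth_pderiv z oO1 O1d (suh y)) x O1p).
rewrite !tauE // uy uz !cfield_self; set c := \sum_k _.
have alg (a b t1 t2 e h d1 d2 f1 f2 : R) :
  0 * a + h * b - (d1 * 0 + e * h * (t1 - c * 0) * f1 -
                   (d2 * 0 + e * h * (t2 - c * 0) * f2)) =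
  h * b - e * h * (t1 * f1 - t2 * f2) by ring.
exact: alg.
Qed.

(** On horizontal vectors the wedge term of [dw'] vanishes; the factor 2 undoes the one half in
    [extd]. *)
Let dw'E y z : horiz p y -> horiz p z ->
  dirder p y (uh' z) = dirder p z (uh' y) + 2 * ipp y (K p z).
Proof.
move=> [hy _] [hz _].
have := dw' y z Op; rewrite /wedge !wE // hy hz !mulr0 subrr !mulr0 subr0.
have -> : extd (fun q z => w' q z : R) p y z =
  2^-1 * (dirder p y (uh' z) - dirder p z (uh' y)) by [].
have alg (a b c : R) : 2^-1 * (a - b) = c -> a = b + 2 * c by move=> h; lra.
exact: alg.
Qed.

(* [d (d w) = 0] evaluated on horizontal vectors. *)
Lemma tensor_deriv_cyclic x y z : horiz p x -> horiz p y -> horiz p z ->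
  ipp y (DA x z) + ipp z (DA y x) + ipp x (DA z y) =
  eps * (s p x * ipp y (K p z) + s p y * ipp z (K p x) + s p z * ipp x (K p y)).
Proof.
move=> hx hy hz.
have om a b c : dirder p a (omega b c) =
    ipp (Gam p a b) (A p c) + (- ipp (A p b) (Gam p a c) + ipp b (DA a c)).
  have h := metric_deriv hLC a oO1 O1p (sE b) (sAE c).
  apply: (etrans h); rewrite nabla_AE nabla_cfield !cfield_self ipDr.
  by rewrite (skewA _ _ Op) opprK.
(* By torsion-freeness the terms in [Gam] cancel in pairs in the cyclic sum. *)
have sG a b c : ipp (Gam p a b) (A p c) = ipp (A p c) (Gam p b a).
  by rewrite (Gam_sym hLC) ipC.
have h1 := dirder_omega x hy hz; rewrite om in h1.
have h2 := dirder_omega y hz hx; rewrite om in h2.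
have h3 := dirder_omega z hx hy; rewrite om in h3.
(* These three equalities of mixed derivatives amount to the vanishing of [d (dw)]. *)
have c1 := dirder_pderivC y x oO1 O1p (suh z).
have c2 := dirder_pderivC z y oO1 O1p (suh x).
have c3 := dirder_pderivC x z oO1 O1p (suh y).
have d1 := dw'E hy hz. have d2 := dw'E hz hx. have d3 := dw'E hx hy.
have g1 := sG x y z. have g2 := sG y z x. have g3 := sG z x y.
exact: cyclic_algebra g1 g2 g3 c1 c2 c3 d1 d2 d3 h1 h2 h3.
Qed.

(** Torsion-freeness turns the four brackets into covariant derivatives; after the Leibniz rule the
    derivatives of [X] and [Y] cancel, and only their values at [p] remain. *)
Lemma nijenhuis_tensor_deriv X Y : smooth_field O1 X -> smooth_field O1 Y ->
  nijenhuis A X Y p = DA (A p (X p)) (Y p) - DA (A p (Y p)) (X p) +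
    A p (DA (Y p) (X p)) - A p (DA (X p) (Y p)).
Proof.
move=> hX hY.
have hA1 : preserves_smooth O1 A by move=> O' Z oO' sO'; apply: sA => // q /sO' /O1O.
have sAX := sA oO1 O1O hX. have sAY := sA oO1 O1O hY.
have tor := nabla_torsion hLC oO1 O1p.
have nA Z x := nabla_tensor Gam (X := Z) x oO1 O1p hA1.
have b1 := tor _ _ hX hY.
have b2 := tor _ _ sAX sAY; rewrite (nA _ _ hX) (nA _ _ hY) in b2.
have b3 := tor _ _ sAX hY; rewrite (nA _ _ hX) in b3.
have b4 := tor _ _ hX sAY; rewrite (nA _ _ hY) in b4.
have lB (u v : 'rV[R]_m) : A p (u - v) = A p u - A p v by exact: linearB.
have lD (u v : 'rV[R]_m) : A p (u + v) = A p u + A p v by exact: linearD.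
have e1 := etrans (f_equal (A p) (etrans (f_equal (A p) b1) (lB _ _))) (lB _ _).
have e3 := etrans (f_equal (A p) b3)
  (etrans (lB _ _) (f_equal (fun v => _ - v) (lD _ _))).
have e4 := etrans (f_equal (A p) b4)
  (etrans (lB _ _) (f_equal (fun v => v - _) (lD _ _))).
have alg (a b c e d1 d2 d3 d4 : 'rV[R]_m) :
    a - b + (c + d1 - (e + d2)) - (c - (b + d3)) - (a + d4 - e) = d1 - d2 + d3 - d4.
  by apply/rowP => k; rewrite !mxE; ring.
have h := f_equal2 +%R (f_equal2 +%R (f_equal2 +%R e1 b2) (f_equal -%R e3))
  (f_equal -%R e4).
exact: (etrans h (alg _ _ _ _ _ _ _ _)).
Qed.

(** Normality speaks of fields that are horizontal on an open set. Removing from a coordinate field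
    its components along the orthonormal pair [W], [W'] gives such a field with a prescribed
    horizontal value at [p]. *)
Definition horiz_part y q : 'rV[R]_m := E y q +
  ((- ip (g q) (W q) (E y q)) *: W q + (- ip (g q) (W' q) (E y q)) *: W' q).

Lemma smooth_horiz_part y : smooth_field O1 (horiz_part y).
Proof.
apply: (smooth_fieldD oO1 (sE y)); apply: (smooth_fieldD oO1).
  apply: (smooth_fieldZ oO1 _ sW1); exact: (smooth_onN oO1 (gS oO1 sW1 (sE y))).
apply: (smooth_fieldZ oO1 _ sW1'); exact: (smooth_onN oO1 (gS oO1 sW1' (sE y))).
Qed.

Lemma horiz_horiz_part y q : O q -> horiz q (horiz_part y q).
Proof.
move=> Oq; have [a b c] := WW Oq.
have c' : ip (g q) (W' q) (W q) = 0 by rewrite ipC.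
by split; rewrite /horiz_part !ipDr !ipZr ?a ?b ?c ?c' !mulr0 !mulr1 ?addr0 ?add0r subrr.
Qed.

Lemma horiz_part_self y : horiz p y -> horiz_part y p = y.
Proof.
by move=> [a b]; rewrite /horiz_part cfield_self a b !oppr0 !scale0r !addr0.
Qed.

Context (skewK : forall x y, ipp (K p x) y = - ipp x (K p y)).
(** The horizontal component of [S = 0] when [A = G], and of [T = 0] when [A = H]; the other terms
    of [S] and [T] are vertical or vanish on horizontal vectors. *)
Context (nijA : forall (O' : set N) X Y, open O' -> O' `<=` O -> O' p ->
  smooth_field O' X -> smooth_field O' Y ->
  (forall q, O' q -> horiz q (X q) /\ horiz q (Y q)) ->
  let x := X p in let y := Y p in
  forall z, horiz p z -> ipp (nijenhuis A X Y p) z +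
    eps * (s p (A p y) * ipp (K p x) z - s p (A p x) * ipp (K p y) z +
           s p x * ipp (A p (K p y)) z - s p y * ipp (A p (K p x)) z) = 0).

Let alpha x y z := ipp (DA x y) z - eps * (s p x * ipp (K p y) z).

Let alpha_skew x y z : alpha x y z = - alpha x z y.
Proof.
rewrite /alpha tensor_deriv_skew (ipC _ _ (gC p)) skewK (ipC y _ (gC p)).
by have alg (a b c e : R) : - a - e * (c * - b) = - (a - e * (c * b)) by ring.
Qed.

Let alpha_cyclic x y z : horiz p x -> horiz p y -> horiz p z ->
  alpha x z y + alpha y x z + alpha z y x = 0.
Proof.
move=> hx hy hz; have := tensor_deriv_cyclic hx hy hz.
rewrite /alpha !(ipC x _ (gC p)) !(ipC y _ (gC p)) !(ipC z _ (gC p)).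
have alg (a b c a' b' c' k e l e' f f' : R) :
    a + b + c = e * (a' + b' + c') -> a - e * a' + (b - e * b') + (c - e * c') = 0.
  by move=> h; lra.
exact: alg.
Qed.

(** Writing [nijA] with [alpha] absorbs [s]: [alpha (A x) y z - alpha (A y) x z - alpha y x (A z) +
    alpha x y (A z) = 0]. The cyclic identity at [x], [y], [A z], with skewness, contracts the last
    two terms to [alpha (A z) y x]. *)
Let alpha_nijenhuis x y z : horiz p x -> horiz p y -> horiz p z ->
  alpha (A p x) y z + alpha (A p y) z x = alpha (A p z) x y.
Proof.
move=> hx hy hz.
have alg2 (a b c e a' b' c' : R) : a - b - c + e = 0 -> a' + c + b' = 0 ->
    e = - a' -> c' = - b -> forall f, f = - b' -> a + c' = f by move=> *; lra.
have := nijA oO1 O1O O1p (smooth_horiz_part x) (smooth_horiz_part y)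
  (fun q O1q => conj (horiz_horiz_part x (O1O O1q)) (horiz_horiz_part y (O1O O1q))) hz.
rewrite (nijenhuis_tensor_deriv (smooth_horiz_part x) (smooth_horiz_part y)).
have ex (u1 u2 u3 u4 v : 'rV[R]_m) : ipp (u1 - u2 + A p u3 - A p u4) v =
    ipp u1 v + - ipp u2 v + - ipp u3 (A p v) + - - ipp u4 (A p v).
  by rewrite !(ipDl, ipNl) !(skewA _ _ Op).
rewrite /= !horiz_part_self // ex (skewA (K p y) z Op) (skewA (K p x) z Op).
have alg (a1 a2 a3 a4 sx sy sAx sAy k1 k2 k3 k4 e : R) :
    a1 + - a2 + - a3 + - - a4 +
    e * (sAy * k2 - sAx * k1 + sx * - k3 - sy * - k4) = 0 ->
    (a1 - e * (sAx * k1)) - (a2 - e * (sAy * k2)) - (a3 - e * (sy * k4)) +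
    (a4 - e * (sx * k3)) = 0 by move=> h; lra.
move/alg => h.
have h1 := alpha_cyclic hx hy (horizA z).
have h2 := alpha_skew x y (A p z).
have h3 := alpha_skew (A p y) z x.
have h4 := alpha_skew (A p z) x y.
exact: alg2 h h1 h2 h3 _ h4.
Qed.

Lemma tensor_deriv_horizontal x y z : horiz p x -> horiz p y -> horiz p z ->
  ipp (DA x y) z = eps * (s p x * ipp (K p y) z).
Proof.
move=> hx hy hz; apply: subr0_eq; rewrite -/(alpha x y z).
have alg (a b c : R) : a + b = c -> c + a = b -> a = 0 by lra.
(* On horizontal vectors [A] has the inverse [- A], so [x] can be written as [A] of a horizontal
   vector. *)
have hx' : horiz p (- A p x) by have [a b] := horizA x; split; rewrite ipNr ?a ?b oppr0.
have ex : A p (- A p x) = x.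
  have e : A p (- A p x) = - A p (A p x) by exact: linearN.
  by rewrite e horiz_sqA // opprK.
have h1 := alpha_nijenhuis hx' hy hz.
have h2 := alpha_nijenhuis hz hx' hy.
rewrite ex in h1 h2.
exact: alg h1 h2.
Qed.

End ContactTensor.

Lemma preserves_smooth_sub (R : realType) m (N : manifold R m) (O O' : set N) A :
  O `<=` O' -> preserves_smooth O' A -> preserves_smooth O A.
Proof. by move=> OO' h O1 X oO1 O1O; apply: h => // q /O1O /OO'. Qed.

(** A plane with an orthonormal basis is its own double orthogonal: the part of [x] orthogonal to
    [a] and [b] turns out orthogonal to every vector, hence zero. *)
Lemma orthogonal_span2 (R : realType) m (B : 'M[R]_m) (a b x : 'rV[R]_m) :
  B^T = B -> B \in unitmx -> ip B a a = 1 -> ip B b b = 1 -> ip B a b = 0 ->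
  (forall z, ip B a z = 0 -> ip B b z = 0 -> ip B x z = 0) ->
  x \in (<[a]> + <[b]>)%VS.
Proof.
move=> sB uB aa bb ab hx; have ba : ip B b a = 0 by rewrite ipC.
have dec t : exists w, [/\ ip B a w = 0, ip B b w = 0 &
    t = w + (ip B a t *: a + ip B b t *: b)].
  exists (t - ip B a t *: a - ip B b t *: b); split.
  - by rewrite !(ipDr, ipNr, ipZr) aa ab mulr1 mulr0 subr0 subrr.
  - by rewrite !(ipDr, ipNr, ipZr) bb ba mulr1 mulr0 subr0 subrr.
  - by rewrite -[t - _ - _]addrA -opprD subrK.
have [w [w1 w2 ex]] := dec x.
have e : w = 0.
  apply: (ip_nondegenerate uB) => z; have [t [t1 t2 ->]] := dec z.
  have h := hx _ t1 t2; rewrite ex !(ipDl, ipZl) t1 t2 !mulr0 !addr0 in h.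
  by rewrite !(ipDr, ipZr) h ![ip B w _]ipC // w1 w2 !mulr0 !addr0.
rewrite ex e add0r.
by apply: memv_add; apply: memvZ; exact: memv_line.
Qed.

(** * Derivatives of [G], [H] and [J] on a normal contact manifold *)

Section ContactGeometry.
Context {R : realType} {n q0 : nat} {N : manifold R (rdim n)}.
Local Notation m := (rdim n).
Context (hN : complex_manifold (k := n.*2.+1) N).
Context {g : N -> 'M[R]_m} (hg : semi_riemannian g q0) (hJ : hermitian_metric g).
Context {Gam : N -> 'Hom('rV[R]_m, 'End('rV[R]_m))} (hLC : levi_civita g Gam).
Context {C : contact_data N} (hCg : contact_metric C g Gam).
Context (hnormal : normal_contact C g Gam).
Implicit Types (p q : N) (O : set N) (x y z : 'rV[R]_m).

Lemma cJE x : cJ R n x = x *m block_mx 0 1%:M (- 1%:M) 0.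
Proof. by rewrite /cJ /stdJ lfunE. Qed.

Lemma cJK x : cJ R n (cJ R n x) = - x.
Proof.
rewrite !cJE -mulmxA mulmx_block !mul0mx !mulmx0 !mul1mx !mulmx1 !add0r !addr0.
have -> : block_mx (- 1%:M) 0 0 (- 1%:M) = - 1%:M :> 'M[R]_(rdim n).
  by rewrite [in RHS]scalar_mx_block opp_block_mx !oppr0.
by rewrite mulmxN mulmx1.
Qed.

(** The Cauchy-Riemann equations of the transition maps make the constant matrix of [cJ] commute
    with changes of chart. *)
Lemma cJ_preserves_smooth O : preserves_smooth O (fun=> cJ R n).
Proof.
move=> O' X oO' _ hX y.
have oy : open (O' `&` dom y) by apply: openI => //; exact: dom_open.
apply: smooth_on_ext oy _ (smooth_on_linear (cJ R n) oy (hX y)) => q [_ dq].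
apply: esym; apply: hN; exact: cimg_mem (dom_mem q) dq.
Qed.

Let gC p : (g p)^T = g p. Proof. by have [h _ _ _] := hg; exact: h. Qed.
Let gS O X Y : open O -> smooth_field O X -> smooth_field O Y ->
  smooth_on O (fun p => ip (g p) (X p) (Y p) : R^o).
Proof. by have [_ _ _ h] := hg; exact: h. Qed.

Section Chart.
Context (i : cover_index C).
Local Notation O := (cover_set i).
Local Notation U := (fU i).
Local Notation V := (fV i).
Local Notation u := (fu i).
Local Notation v := (fv i).
Local Notation G := (tG i).
Local Notation H := (tH i).
Local Notation J := (cJ R n).
Local Notation s := (sigma g Gam i).

Lemma tG_preserves_smooth : preserves_smooth O G.
Proof. by have [h _ _ _ _] := hCg; have [_ h2] := h i. Qed.

Lemma fU_smooth : smooth_field O U.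
Proof. by have [h _ _ _ _] := hCg; have [h2 _] := h i. Qed.

Lemma fV_smooth : open O -> smooth_field O V.
Proof.
move=> oO; have h := cJ_preserves_smooth oO (@subset_refl _ O) fU_smooth.
have e : V = fun q => (fun=> -1 : R^o) q *: J (U q).
  by apply/funext => q; rewrite scaleN1r.
rewrite e; exact: smooth_fieldZ oO (smooth_on_cst O (-1 : R^o)) h.
Qed.

Lemma tH_preserves_smooth : preserves_smooth O H.
Proof.
move=> O' X oO' sO' hX.
have h := tG_preserves_smooth oO' sO' (cJ_preserves_smooth oO' sO' hX).
have e : (fun q => H q (X q)) = fun q => G q (J (X q)).
  by apply/funext => q; rewrite lfunE.
by rewrite e.
Qed.

Section Point.
Context (q : N) (Oq : O q).
Local Notation ipq := (ip (g q)).

Let c3 : [/\ structure_square i q (G q) /\ structure_square i q (H q),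
  forall x y, ipq (G q x) y = - ipq x (G q y),
  (forall x, ipq (U q) x = u q x) /\ ipq (U q) (V q) = 0,
  (G q \o J = - (J \o G q))%VF & G q (U q) = 0 /\ u q (U q) = 1].
Proof. by have [_ _ h _ _] := hCg; exact: h. Qed.

Lemma fuE x : u q x = ipq (U q) x.
Proof. by have [_ _ [h _] _ _] := c3; rewrite h. Qed.

Lemma cJ_skew x y : ipq (J x) y = - ipq x (J y).
Proof. by rewrite -hJ cJK ipNl. Qed.

Lemma fvE x : v q x = ipq (V q) x.
Proof. by rewrite ipNl cJ_skew opprK -fuE lfunE. Qed.

Lemma tH_E x : H q x = G q (J x). Proof. by rewrite lfunE. Qed.

Lemma tG_cJ x : G q (J x) = - J (G q x).
Proof.
have [_ _ _ h _] := c3.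
have := f_equal (fun f : 'End('rV[R]_m) => f x) h.
by rewrite opp_lfunE !comp_lfunE.
Qed.

Lemma tG_skew x y : ipq (G q x) y = - ipq x (G q y).
Proof. by have [_ h _ _ _] := c3. Qed.

Lemma tH_skew x y : ipq (H q x) y = - ipq x (H q y).
Proof. by rewrite !tH_E tG_skew cJ_skew opprK tG_cJ ipNr opprK. Qed.

Lemma tG_kernel : G q (U q) = 0 /\ G q (V q) = 0.
Proof.
have [_ _ _ _ [h _]] := c3; split=> //.
have e : G q (V q) = - G q (J (U q)) by exact: linearN.
by rewrite e tG_cJ h linear0 !oppr0.
Qed.

Lemma tH_kernel : H q (V q) = 0 /\ H q (U q) = 0.
Proof.
have [_ _ _ _ [h _]] := c3; split; rewrite tH_E; last by rewrite tG_cJ h linear0 oppr0.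
have e : J (V q) = - J (J (U q)) by exact: linearN.
by rewrite e cJK opprK.
Qed.

Lemma char_orthonormal :
  [/\ ipq (U q) (U q) = 1, ipq (V q) (V q) = 1 & ipq (U q) (V q) = 0].
Proof.
have [_ _ [_ h2] _ [_ h]] := c3.
have e : ipq (U q) (U q) = 1 by rewrite -fuE.
by split=> //; rewrite ipNl ipNr opprK hJ.
Qed.

Lemma tG_sq x : G q (G q x) = - x + u q x *: U q + v q x *: V q.
Proof. by have [[h _] _ _ _ _] := c3; exact: h. Qed.

Lemma tH_sq x : H q (H q x) = - x + v q x *: V q + u q x *: U q.
Proof. by have [[_ h] _ _ _ _] := c3; rewrite addrAC; exact: h. Qed.

Lemma tH_tG x : H q (G q x) = - G q (H q x).
Proof. by rewrite !tH_E [G q (J x)]tG_cJ linearN opprK [RHS]tG_cJ tG_cJ. Qed.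

(** The explicit factors [1] and [-1] here and in the three lemmas below are the values of [eps]:
    unprimed for [(G, H, u, v)], primed for [(H, G, v, u)]. *)
Lemma du_structure x y : extd (fun q z => u q z : R) q x y =
  ipq x (G q y) + 1 * wedge (s q) (fun z => v q z : R) x y.
Proof. by have [_ _ _ _ h] := hCg; rewrite mul1r; have [e _] := h i q x y Oq. Qed.

Lemma du_structure' x y : extd (fun q z => u q z : R) q x y =
  ipq x (G q y) - (-1) * wedge (s q) (fun z => v q z : R) x y.
Proof. by rewrite mulN1r opprK -[X in _ + X]mul1r; exact: du_structure. Qed.

Lemma dv_structure x y : extd (fun q z => v q z : R) q x y =
  ipq x (H q y) - 1 * wedge (s q) (fun z => u q z : R) x y.
Proof. by have [_ _ _ _ h] := hCg; rewrite mul1r; have [_ e] := h i q x y Oq. Qed.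

Lemma dv_structure' x y : extd (fun q z => v q z : R) q x y =
  ipq x (H q y) + (-1) * wedge (s q) (fun z => u q z : R) x y.
Proof. by rewrite mulN1r -[X in - X]mul1r; exact: dv_structure. Qed.

Lemma horiz_horizontal x : horiz (g := g) U V q x -> x \in horizontal g i q.
Proof.
move=> [h1 h2]; apply/memv_orthv => y /memv_addP[a /vlineP[k ->] [b /vlineP[l ->] ->]].
by rewrite ipDl !ipZl h1 h2 !mulr0 addr0.
Qed.

End Point.

Section Derivatives.
Context (oO : open O) (p : N) (Op : O p).
Local Notation ipp := (ip (g p)).
Local Notation hor x := (horiz (g := g) U V p x).

Lemma horiz_swap q x : horiz (g := g) V U q x -> horiz (g := g) U V q x.
Proof. by case. Qed.

Lemma nijenhuis_tG (O' : set N) X Y : open O' -> O' `<=` O -> O' p ->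
  smooth_field O' X -> smooth_field O' Y ->
  (forall q, O' q -> horiz (g := g) U V q (X q) /\ horiz (g := g) U V q (Y q)) ->
  let x := X p in let y := Y p in
  forall z, hor z -> ipp (nijenhuis G X Y p) z +
    1 * (s p (G p y) * ipp (H p x) z - s p (G p x) * ipp (H p y) z +
         s p x * ipp (G p (H p y)) z - s p y * ipp (G p (H p x)) z) = 0.
Proof.
move=> oO' O'O O'p sX sY hXY x y z [z1 z2].
have ex (t ku kv k1 k2 k3 k4 : 'rV[R]_m) (a b e1 e2 e3 e4 : R) :
    ipp ku z = 0 -> ipp kv z = 0 ->
    ipp (t + a *: ku - b *: kv + e1 *: k1 - e2 *: k2 + e3 *: k3 - e4 *: k4) z =
    ipp t z + 1 * (e1 * ipp k1 z - e2 * ipp k2 z + e3 * ipp k3 z - e4 * ipp k4 z).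
  by move=> zu zv; rewrite !(ipDl, ipNl, ipZl) zu zv; ring.
have hor q : O' q -> X q \in horizontal g i q /\ Y q \in horizontal g i q.
  by move=> O'q; have [a b] := hXY q O'q; split; exact: horiz_horizontal.
have [h _] := hnormal oO' O'O sX sY.
have [hS _] := h hor p O'p.
have [[_ x2] [_ y2]] := hXY p O'p.
have := f_equal (fun t => ipp t z) hS; rewrite ip0l /tensorS.
rewrite -/x -/y -/(s p) !(fvE Op) x2 y2 !scale0r subrr scaler0 addr0.
by move=> h1; apply: etrans h1; apply: esym; exact: ex z1 z2.
Qed.

Lemma nijenhuis_tH (O' : set N) X Y : open O' -> O' `<=` O -> O' p ->
  smooth_field O' X -> smooth_field O' Y ->
  (forall q, O' q -> horiz (g := g) V U q (X q) /\ horiz (g := g) V U q (Y q)) ->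
  let x := X p in let y := Y p in
  forall z, horiz (g := g) V U p z -> ipp (nijenhuis H X Y p) z +
    (-1) * (s p (H p y) * ipp (G p x) z - s p (H p x) * ipp (G p y) z +
         s p x * ipp (H p (G p y)) z - s p y * ipp (H p (G p x)) z) = 0.
Proof.
move=> oO' O'O O'p sX sY hXY x y z [z2 z1].
have ex (t ku kv k1 k2 k3 k4 : 'rV[R]_m) (a b e1 e2 e3 e4 : R) :
    ipp ku z = 0 -> ipp kv z = 0 ->
    ipp (t - a *: ku + b *: kv + e1 *: k1 - e2 *: k2 + e3 *: k3 - e4 *: k4) z =
    ipp t z + (-1) * (e2 * ipp k2 z - e1 * ipp k1 z + e3 * ipp (- k3) z -
      e4 * ipp (- k4) z).
  by move=> zu zv; rewrite !(ipDl, ipNl, ipZl) zu zv; ring.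
have hor q : O' q -> X q \in horizontal g i q /\ Y q \in horizontal g i q.
  move=> O'q; have [/horiz_swap a /horiz_swap b] := hXY q O'q.
  by split; exact: horiz_horizontal.
have [h _] := hnormal oO' O'O sX sY.
have [_ hT] := h hor p O'p.
have [[_ x2] [_ y2]] := hXY p O'p.
have := f_equal (fun t => ipp t z) hT; rewrite ip0l /tensorT.
rewrite -/x -/y -/(s p) !(fuE Op) x2 y2 !scale0r subrr scaler0 addr0.
(* [T] is written with [G H], the abstract relation for [A = H] with [H G]; anticommutation accounts
   for the sign. *)
rewrite !(tH_tG Op).
by move=> h1; apply: etrans h1; apply: esym; exact: ex z1 z2.
Qed.

Lemma tG_deriv x y z : hor x -> hor y -> hor z ->
  ipp (tensor_deriv Gam G p x y) z = 1 * (s p x * ipp (H p y) z).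
Proof.
apply: (tensor_deriv_horizontal hLC gC gS oO tG_preserves_smooth fU_smooth (fV_smooth oO)
  (fun q Oq => tG_kernel Oq) (fun q x Oq => fuE Oq x) (fun q x Oq => fvE Oq x)
  (fun q Oq => char_orthonormal Oq) (fun q x y Oq => tG_skew Oq x y)
  (fun q x Oq => tG_sq Oq x) (fun q x y Oq => du_structure Oq x y)
  (fun q x y Oq => dv_structure Oq x y) Op (tH_skew Op) nijenhuis_tG).
Qed.

Lemma tH_deriv x y z : hor x -> hor y -> hor z ->
  ipp (tensor_deriv Gam H p x y) z = -1 * (s p x * ipp (G p y) z).
Proof.
move=> [x1 x2] [y1 y2] [z1 z2].
have WW q : O q -> [/\ ip (g q) (V q) (V q) = 1, ip (g q) (U q) (U q) = 1
    & ip (g q) (V q) (U q) = 0].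
  by move=> Oq; have [a b c] := char_orthonormal Oq; split=> //; rewrite ipC.
apply: (tensor_deriv_horizontal hLC gC gS oO tH_preserves_smooth (fV_smooth oO) fU_smooth
  (fun q Oq => tH_kernel Oq) (fun q x Oq => fvE Oq x) (fun q x Oq => fuE Oq x)
  WW (fun q x y Oq => tH_skew Oq x y)
  (fun q x Oq => tH_sq Oq x) (fun q x y Oq => dv_structure' Oq x y)
  (fun q x y Oq => du_structure' Oq x y) Op (tG_skew Op) nijenhuis_tH); by split.
Qed.

Lemma cJ_horiz y : hor y -> hor (J y).
Proof.
move=> [y1 y2]; split.
  have e : fv i p y = fu i p (J y) by rewrite lfunE.
  by rewrite -(fuE Op) -e (fvE Op).
by rewrite ipNl hJ y1 oppr0.
Qed.

Lemma tG_horiz y : hor (G p y).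
Proof.
have [a b] := tG_kernel Op.
by split; rewrite ipC // (tG_skew Op) ?a ?b ip0r oppr0.
Qed.

Lemma tH_deriv_cJ x y : tensor_deriv Gam H p x y =
  G p (tensor_deriv Gam (fun=> J) p x y) + tensor_deriv Gam G p x (J y).
Proof.
pose O1 := O `&` dom p.
have oO1 : open O1 by apply: openI => //; exact: dom_open.
have O1p : O1 p by split=> //; exact: dom_mem.
have sE : smooth_field O1 (cfield p y) by apply: smooth_cfield => // q [].
have sJE := cJ_preserves_smooth oO1 (@subset_refl _ O1) sE.
have pG : preserves_smooth O1 G.
  by apply: preserves_smooth_sub tG_preserves_smooth => q [].
have h1 := nabla_tensor Gam x oO1 O1p pG sJE.
have h2 := nabla_tensor Gam x oO1 O1p (@cJ_preserves_smooth O1) sE.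
rewrite nabla_cfield cfield_self in h2; rewrite h2 cfield_self in h1.
have e : (fun q => H q (cfield p y q)) = fun q => G q (J (cfield p y q)).
  by apply/funext => q; rewrite tH_E.
have lD (a b : 'rV[R]_m) : G p (a + b) = G p a + G p b by exact: linearD.
have alg (a b c : 'rV[R]_m) : a + b + c - a = b + c.
  by rewrite addrC -addrA addKr.
rewrite {1}/tensor_deriv e h1 lD tH_E.
exact: alg.
Qed.

(** The identity [nabla H = G (nabla J) + (nabla G) J] is paired with [- G z], the preimage of [z]
    under [G]. Since [H J = - G], the terms in [s] on the two sides agree, and only [nabla J] is
    left. *)
Lemma cJ_deriv x y z : hor x -> hor y -> hor z ->
  ipp (tensor_deriv Gam (fun=> J) p x y) z = 0.
Proof.
move=> hx hy hz.
have hz' : hor (- G p z).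
  by have [a b] := tG_horiz z; split; rewrite ipNr ?a ?b oppr0.
have ez : G p (- G p z) = z.
  have e : G p (- G p z) = - G p (G p z) by exact: linearN.
  have [z1 z2] := hz.
  by rewrite e (tG_sq Op) (fuE Op) (fvE Op) z1 z2 !scale0r !addr0 opprK.
have h1 := tG_deriv hx (cJ_horiz hy) hz'.
have h2 := tH_deriv hx hy hz'.
have e : H p (J y) = - G p y.
  by rewrite tH_E cJK; exact: linearN.
rewrite e ipNl in h1.
rewrite tH_deriv_cJ ipDl h1 (tG_skew Op) ez in h2.
have alg (a b c : R) : - a + 1 * (b * - c) = -1 * (b * c) -> a = 0.
  by move=> h; lra.
exact: alg h2.
Qed.

(** A common form for the three structures: [G] leads to [H] with factor [s], [H] to [G] with factor
    [- s], and [J] to zero. What counts later is that every [J_b] maps the screen into [S(TM^perp)],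
    whichever [b] occurs. *)
Lemma Jtens_deriv (a : 'I_3) : exists (b : 'I_3) (c : 'rV[R]_m -> R),
  forall x y z, hor x -> hor y -> hor z ->
  ipp (tensor_deriv Gam (Jtens i a) p x y) z = c x * ipp (Jtens i b p y) z.
Proof.
case: a => [[|[|[|//]]] ha].
(* With coefficient 0 the index is a mere placeholder. *)
- exists ord0, (fun=> 0) => x y z hx hy hz; rewrite mul0r.
  have e : Jtens i (Ordinal ha) = fun=> J by apply/funext => q; rewrite /Jtens (tnth_nth 0).
  by rewrite e cJ_deriv.
- exists (Ordinal (isT : (2 < 3)%N)), (fun x => s p x) => x y z hx hy hz.
  have e : Jtens i (Ordinal ha) = G by apply/funext => q; rewrite /Jtens (tnth_nth 0).
  by rewrite e tG_deriv // mul1r /Jtens (tnth_nth 0).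
- exists (Ordinal (isT : (1 < 3)%N)), (fun x => - s p x) => x y z hx hy hz.
  have e : Jtens i (Ordinal ha) = H by apply/funext => q; rewrite /Jtens (tnth_nth 0).
  by rewrite e tH_deriv // mulN1r mulNr /Jtens (tnth_nth 0).
Qed.

Lemma Jtens_preserves_smooth (a : 'I_3) : preserves_smooth O (Jtens i a).
Proof.
case: a => [[|[|[|//]]] ha].
- have e : Jtens i (Ordinal ha) = fun=> J by apply/funext => q; rewrite /Jtens (tnth_nth 0).
  by rewrite e; exact: cJ_preserves_smooth.
- have e : Jtens i (Ordinal ha) = G by apply/funext => q; rewrite /Jtens (tnth_nth 0).
  by rewrite e; exact: tG_preserves_smooth.
- have e : Jtens i (Ordinal ha) = H by apply/funext => q; rewrite /Jtens (tnth_nth 0).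
  by rewrite e; exact: tH_preserves_smooth.
Qed.

Lemma Jtens_sq (a : 'I_3) x : hor x -> Jtens i a p (Jtens i a p x) = - x.
Proof.
move=> [x1 x2]; case: a => [[|[|[|//]]] ha]; rewrite /Jtens (tnth_nth 0) /=.
- exact: cJK.
- by rewrite (tG_sq Op) (fuE Op) (fvE Op) x1 x2 !scale0r !addr0.
- by rewrite (tH_sq Op) (fuE Op) (fvE Op) x1 x2 !scale0r !addr0.
Qed.

Lemma horiz_orth_char x : (forall z, hor z -> ipp x z = 0) -> x \in charV i p.
Proof.
move=> hx; have [uu vv uv] := char_orthonormal Op; have [_ gU _ _] := hg.
by apply: (orthogonal_span2 (gC p) (gU p) uu vv uv) => z z1 z2; exact: hx.
Qed.

End Derivatives.
End Chart.
End ContactGeometry.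

(** * Screen real null submanifolds *)

Section LinearAlgebra.
Context {R : realType} {m : nat}.
Implicit Types (x : 'rV[R]_m) (U W : {vspace 'rV[R]_m}).

Lemma basis_codomP r (f : 'I_r -> 'rV[R]_m) U x : basis_of U (codom f) ->
  x \in U -> exists c : 'I_r -> R, x = \sum_k c k *: f k.
Proof.
move=> /andP[/eqP <- _] xU.
have := coord_span (X := [tuple of codom f]) xU.
set c := fun j => coord [tuple of codom f] j x => ex.
exists (fun k => c (enum_rank k)).
have -> : \sum_k c (enum_rank k) *: f k = \sum_(k in 'I_r) c (enum_rank k) *: f k.
  exact: eq_bigl.
rewrite {1}ex [RHS]big_enum_val.
by apply: eq_bigr => j _; rewrite enum_valK (nth_codom 0).
Qed.

Lemma daddv_pi_kernel U W x : (U :&: W = 0)%VS -> x \in W -> daddv_pi U W x = 0.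
Proof.
move=> UW xW; have WU : (W :&: U = 0)%VS by rewrite capvC.
have h : x \in (U + W)%VS by rewrite (subvP (addvSr U W)).
have := daddv_pi_add UW h; rewrite (daddv_pi_id WU xW).
by move=> e; apply: (addIr x); rewrite e add0r.
Qed.

End LinearAlgebra.

(** * The splitting of the ambient tangent bundle along [M] *)

Section NullDecomposition.
Context {R : realType} {d m r : nat} {M : manifold R d} {N : manifold R m}.
Context {iota : M -> N} {g : N -> 'M[R]_m} (gC : forall p, (g p)^T = g p).
Context {B : screen_data m M} (hS : screen_distribution iota g B).
Context (hSperp : screen_transversal iota g B) (hltr : null_transversal iota g B r).
Implicit Types (p : M) (x y : 'rV[R]_m).

Lemma scr_tangent p : (scr B p <= TM iota p)%VS.
Proof. by have [_ h] := hS; have [_ <- _] := h p; exact: addvSr. Qed.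

Lemma rad_tangent p : (RadTM iota g p <= TM iota p)%VS.
Proof. exact: capvSl. Qed.

Lemma scrperp_orth p x y : x \in scrperp B p -> y \in TM iota p ->
  ip (g (iota p)) x y = 0.
Proof.
move=> xs yT; rewrite ipC //.
have [_ h] := hSperp; have [_ e _] := h p.
have : x \in TMperp iota g p by rewrite -e (subvP (addvSr _ _)).
by move=> /memv_orthv; exact.
Qed.

(** If [rho + tau = l + s], pairing with [Nn k] extracts a coefficient of [rho] on the left and
    gives zero on the right, since the [Nn] are isotropic and orthogonal to [scr] and [scrperp].
    Then [tau = l + s] is orthogonal to the nondegenerate [scr]. Disjointness makes the [daddv_pi]
    in [shape_op] a genuine projection. *)
Lemma tangent_transversal_disjoint p :
  (TM iota p :&: (ltr B p + scrperp B p) = 0)%VS.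
Proof.
have [A [xi [Nn [_ Ap _ h]]]] := hltr p.
have [bxi bN orthN xiN NN] := h p Ap.
have [_ hS2] := hS; have [ndS eS _] := hS2 p.
apply/eqP; rewrite -subv0; apply/subvP => t /memv_capP[tT].
move=> /memv_addP[l lL [s sS et]].
have := tT; rewrite -eS => /memv_addP[rho rhoR [tau tauS et']].
have [cl el] := basis_codomP bN lL.
have [cr er] := basis_codomP bxi rhoR.
have ipN x y k : y = \sum_j cl j *: Nn j p -> (forall j, ip (g (iota p)) x (Nn j p) = 0) ->
    ip (g (iota p)) x y = 0.
  by move=> -> hx; rewrite ip_sumr big1 // => j _; rewrite hx mulr0.
have cr0 k : cr k = 0.
  have [oS oSp] := orthN k.
  have e1 : ip (g (iota p)) (Nn k p) t = cr k.
    have /memv_orthv/(_ _ tauS) z1 := oS.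
    rewrite et' ipDr [X in _ + X]ipC // z1 addr0 er ip_sumr.
    rewrite (bigD1 k) //= ipC // xiN eqxx mulr1 big1 ?addr0 // => j jk.
    by rewrite ipC // xiN (negPf jk) mulr0.
  have /memv_orthv/(_ _ sS) z2 := oSp.
  rewrite -e1 et ipDr [X in _ + X]ipC // z2 addr0 el ip_sumr big1 // => j _.
  by rewrite NN mulr0.
have rho0 : rho = 0.
  by rewrite er big1 // => k _; rewrite cr0 scale0r.
have tau0 : tau = 0.
  apply/eqP; rewrite -memv0 -ndS; apply/memv_capP; split=> //.
  apply/memv_orthv => y yS.
  have -> : tau = l + s by rewrite -et et' rho0 add0r.
  rewrite ipDr [X in _ + X]ipC // (scrperp_orth sS (subvP (scr_tangent p) _ yS)) addr0.
  rewrite el ip_sumr big1 // => j _.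
  by have [/memv_orthv/(_ _ yS) -> _] := orthN j; rewrite mulr0.
by rewrite et' rho0 tau0 addr0 mem0v.
Qed.

(** Both projections fix radical vectors, and the first one kills [scrperp], which is part of the
    transversal bundle. *)
Lemma rad_component_decomposition p x y : x \in RadTM iota g p -> y \in scrperp B p ->
  rad_component iota g B p
    (daddv_pi (TM iota p) (ltr B p + scrperp B p)%VS (x + y)) = x.
Proof.
move=> xR ys; have dis := tangent_transversal_disjoint p.
rewrite linearD /= (daddv_pi_id dis (subvP (rad_tangent p) _ xR)).
rewrite (daddv_pi_kernel dis); last by rewrite (subvP (addvSr _ _)).
have [_ hS2] := hS; have [_ _ d0] := hS2 p.
by rewrite addr0 /rad_component (daddv_pi_id d0 xR).
Qed.

End NullDecomposition.

(** * Brackets of screen sections *)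

Section ScreenReal.
Context {R : realType} {n q0 d r : nat} {N : manifold R (rdim n)}.
Local Notation m := (rdim n).
Context (hN : complex_manifold (k := n.*2.+1) N).
Context {g : N -> 'M[R]_m} (hg : semi_riemannian g q0) (hJ : hermitian_metric g).
Context {Gam : N -> 'Hom('rV[R]_m, 'End('rV[R]_m))} (hLC : levi_civita g Gam).
Context {C : contact_data N} (hC : complex_contact C) (hCg : contact_metric C g Gam).
Context (hnormal : normal_contact C g Gam).
Context {M : manifold R d} {iota : M -> N} (hM : null_submanifold iota g r).
Context {B : screen_data m M} (hS : screen_distribution iota g B).
Context (hSperp : screen_transversal iota g B) (hltr : null_transversal iota g B r).
Context (hreal : screen_real C iota g B).

Let gC p : (g p)^T = g p. Proof. by have [h _ _ _] := hg; exact: h. Qed.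
Let smooth_iota : smooth_map iota. Proof. by have [[h _ _] _ _] := hM. Qed.

Lemma tangent_horiz (i : cover_index C) p x : cover_set i (iota p) ->
  x \in TM iota p -> horiz (g := g) (fU i) (fV i) (iota p) x.
Proof.
move=> ip_ xT; have [hV _] := hreal ip_.
have hc := subvP hV; split; apply: (scrperp_orth gC hSperp) xT; apply: hc.
  by rewrite (subvP (addvSl _ _)) ?memv_line.
by rewrite (subvP (addvSr _ _)) ?memv_line.
Qed.

(** Modulo the characteristic bundle the difference equals [c x *: J_b y - c y *: J_b x]; the images
    of the screen under [J_b] and the characteristic bundle all lie in [scrperp]. *)
Lemma tensor_deriv_screen (i : cover_index C) (a : 'I_3) p x y :
  cover_set i (iota p) -> x \in scr B p -> y \in scr B p ->
  tensor_deriv Gam (Jtens i a) (iota p) x y -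
  tensor_deriv Gam (Jtens i a) (iota p) y x \in scrperp B p.
Proof.
move=> ip_ xS yS; have [hV hJJ] := hreal ip_.
have oi : open (cover_set i) by have [[h _] _ _ _] := hC; exact: h.
have [b [c hb]] := Jtens_deriv hN hg hJ hLC hCg hnormal oi ip_ a.
have [_ hbS] := hJJ b.
have Jb z : z \in scr B p -> Jtens i b (iota p) z \in scrperp B p.
  by move=> zS; apply: (subvP hbS); exact: memv_img.
have hx := tangent_horiz ip_ (subvP (scr_tangent hS p) _ xS).
have hy := tangent_horiz ip_ (subvP (scr_tangent hS p) _ yS).
set T := tensor_deriv _ _ _.
pose e := c x *: Jtens i b (iota p) y - c y *: Jtens i b (iota p) x.
have eS : e \in scrperp B p by rewrite rpredB ?rpredZ ?Jb.
rewrite -(subrK e (T x y - T y x)) rpredD //; apply: (subvP hV).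
apply: (horiz_orth_char hg hJ hCg ip_) => z hz.
have alg (u v k l : 'rV[R]_m) (s t : R) :
    ip (g (iota p)) u z = s * ip (g (iota p)) k z ->
    ip (g (iota p)) v z = t * ip (g (iota p)) l z ->
    ip (g (iota p)) (u - v - (s *: k - t *: l)) z = 0.
  by rewrite !(ipDl, ipNl, ipZl) => -> ->; rewrite subrr.
exact: alg (hb _ _ _ hx hy hz) (hb _ _ _ hy hx hz).
Qed.

(* Torsion-freeness gives [nabla_Y (J_a X) - nabla_X (J_a Y) = - J_a [X, Y]]
   modulo [S(TM^perp)]; [J_a] sends the screen part of [X, Y] into
   [S(TM^perp)] and its radical part into the radical. *)
Lemma rad_component_bracket (a : 'I_3) (X Y : M -> 'rV[R]_d) (i : cover_index C) p :
  screen_section iota B X -> screen_section iota B Y -> cover_set i (iota p) ->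
  let JX := fun s => Jtens i a (iota s) (dmap iota s (X s)) in
  let JY := fun s => Jtens i a (iota s) (dmap iota s (Y s)) in
  exists rho tau, [/\ rho \in RadTM iota g p, tau \in scr B p,
    dmap iota p (bracket X Y p) = rho + tau &
    rad_component iota g B p
      (- shape_op iota Gam B JX p (Y p) + shape_op iota Gam B JY p (X p)) =
    - Jtens i a (iota p) rho].
Proof.
move=> [sX hX] [sY hY] ip_ JX JY.
have [hV hJJ] := hreal ip_; have [JR JS] := hJJ a.
have oi : open (cover_set i) by have [[h _] _ _ _] := hC; exact: h.
have pJ := Jtens_preserves_smooth hN hCg (i := i) a.
have sGam := Gam_sym hLC (iota p).
have [_ hS2] := hS; have [_ eTM _] := hS2 p.
have bT : dmap iota p (bracket X Y p) \in (RadTM iota g p + scr B p)%VS.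
  by rewrite eTM; exact: memv_img (memvf _).
have /memv_addP[rho rhoR [tau tauS eb]] := bT.
exists rho, tau; split=> //.
have [dX _] := pushforward_derive smooth_iota (Y p) openT (I : setT p) sX.
have [dY _] := pushforward_derive smooth_iota (X p) openT (I : setT p) sY.
have cX := cov_tensor Gam smooth_iota (Y p) oi ip_ pJ dX.
have cY := cov_tensor Gam smooth_iota (X p) oi ip_ pJ dY.
have tor := cov_torsion smooth_iota openT (I : setT p) sX sY sGam.
have tS := tensor_deriv_screen a ip_ (hY p) (hX p).
set J := Jtens i a (iota p) in cX cY JR JS *.
have JrhoR : - J rho \in RadTM iota g p.
  by rewrite rpredN -JR; exact: memv_img.
have JtauS : J tau \in scrperp B p by apply: (subvP JS); exact: memv_img.
set pi := daddv_pi (TM iota p) (ltr B p + scrperp B p)%VS.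
(* The minus sign in [shape_op] turns the expression into the tangential projection of
   [nabla_Y (J_a X) - nabla_X (J_a Y)]. *)
have e0 : - shape_op iota Gam B JX p (Y p) + shape_op iota Gam B JY p (X p) =
    pi (cov Gam iota JX p (Y p) - cov Gam iota JY p (X p)).
  by rewrite /shape_op opprK [RHS]linearB.
have e1 : cov Gam iota JX p (Y p) - cov Gam iota JY p (X p) =
    - J rho + (- J tau +
      (tensor_deriv Gam (Jtens i a) (iota p) (dmap iota p (Y p)) (dmap iota p (X p)) -
       tensor_deriv Gam (Jtens i a) (iota p) (dmap iota p (X p)) (dmap iota p (Y p)))).
  have alg (s t u v k l : 'rV[R]_m) : s - t = - (k + l) ->
      J s + u - (J t + v) = - J k + (- J l + (u - v)).
    have JB (x y : 'rV[R]_m) : J (x - y) = J x - J y by exact: linearB.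
    have JN (x : 'rV[R]_m) : J (- x) = - J x by exact: linearN.
    move=> h; have e : J s - J t = - J k - J l.
      by rewrite -JB h opprD JB JN.
    by rewrite (opprD (J t)) addrACA e -addrA.
  apply: (etrans (f_equal2 (fun s t => s - t) cX cY)).
  by apply: alg; rewrite -eb; exact: tor.
rewrite e0 e1; apply: (rad_component_decomposition gC hS hSperp hltr) => //.
by rewrite rpredD // rpredN.
Qed.

End ScreenReal.

Theorem theorem4p8 (R : realType) (n q d r : nat) (hq : (0 < q < n)%N)
    (N : manifold R (rdim n)) (hN : complex_manifold (k := n.*2.+1) N)
    (g : N -> 'M[R]_(rdim n)) (hg : semi_riemannian g (4 * q)%N)
    (hJ : hermitian_metric g)
    (Gam : N -> 'Hom('rV[R]_(rdim n), 'End('rV[R]_(rdim n))))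
    (hGam : levi_civita g Gam)
    (C : contact_data N) (hC : complex_contact C)
    (hCg : contact_metric C g Gam) (hnormal : normal_contact C g Gam)
    (M : manifold R d) (iota : M -> N) (hM : null_submanifold iota g r)
    (B : screen_data (rdim n) M)
    (hS : screen_distribution iota g B)
    (hSperp : screen_transversal iota g B)
    (hltr : null_transversal iota g B r)
    (hreal : screen_real C iota g B)
    (a : 'I_3) :
  screen_integrable iota B <->
  forall X Y : M -> 'rV[R]_d,
    screen_section iota B X -> screen_section iota B Y ->
    forall (i : cover_index C) (p : M), cover_set i (iota p) ->
      let JX := fun s => Jtens i a (iota s) (dmap iota s (X s)) in
      let JY := fun s => Jtens i a (iota s) (dmap iota s (Y s)) in
      rad_component iota g B p
        (- shape_op iota Gam B JX p (Y p) + shape_op iota Gam B JY p (X p)) = 0.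
Proof.
have gC p : (g p)^T = g p by have [h _ _ _] := hg; exact: h.
have key := rad_component_bracket hN hg hJ hGam hC hCg hnormal hM hS hSperp hltr hreal a.
split=> [hint X Y sX sY i p ip_ /=|hrad X Y sX sY p].
- have [rho [tau [rhoR tauS eb ->]]] := key X Y i p sX sY ip_.
  have bS := hint X Y sX sY p.
  have [_ hS2] := hS; have [_ _ d0] := hS2 p.
  (* The difference of the bracket and [tau] lies in the screen as well as in the radical. *)
  have rho0 : rho = 0.
    apply/eqP; rewrite -memv0 -d0; apply/memv_capP; split=> //.
    by rewrite -(addrK tau rho) -eb rpredB.
  by rewrite rho0 linear0 oppr0.
- have [[_ hcov] _ _ _] := hC; have [i ip_] := hcov (iota p).
  have [rho [tau [rhoR tauS eb er]]] := key X Y i p sX sY ip_.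
  have := hrad X Y sX sY i p ip_; rewrite /= er => /eqP; rewrite oppr_eq0 => /eqP J0.
  (* Radical vectors are tangent, hence horizontal, and there [J_a] squares to minus the identity;
     so [J_a rho = 0] forces [rho = 0]. *)
  have hr := tangent_horiz hg hSperp hreal ip_ (subvP (rad_tangent p) _ rhoR).
  have := Jtens_sq hJ hCg ip_ a hr; rewrite J0 linear0 => /eqP.
  rewrite eq_sym oppr_eq0 => /eqP rho0.
  by rewrite eb rho0 add0r.
Qed.
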